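(* Assume (A1)–(A3). Let $(u,p)$ be the solution of the continuous problem, $(\tilde u_h,\tilde p_h)$ its elliptic projection, $(u_h,p_h)$ a solution of the semi-discrete problem with $u_h(0)=\tilde u_h(0)$, $p_h(0)=\tilde p_h(0)$ (all defined in the context), and let $\delta u_h=u_h-\tilde u_h$, $\delta p_h=p_h-\tilde p_h$. Then $$\|\delta u_h(t)\|_{\mathcal V}^2+\int_0^t\|\delta p_h(s)\|_{\mathcal Q}^2\,ds\le\int_0^t\|B(\dot u(s)-\dot{\tilde u}_h(s))\|_{\mathcal Q_0^*}^2\,ds,\qquad0\le t\le T.$$ If also (A3h) holds, i.e. $\sup_{v_h\in\mathcal V_h,\,\|v_h\|_{\mathcal V}=1}b(v_h,q_h)\ge\beta_h\|q_h\|_{\mathcal Q_0}$ for all $q_h\in\mathcal Q_h$ with some $\beta_h>0$, then additionally $$\beta_h\|\delta p_h(t)\|_{\mathcal Q_0}\le\|\delta u_h(t)\|_{\mathcal V}.$$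
   Context: $\mathcal V,\mathcal Q,\mathcal Q_0$ are real Hilbert spaces with compact embedding $\mathcal Q\subset\mathcal Q_0$; identifying $\mathcal Q_0$ with its dual one has a Gelfand triple $\mathcal Q\subset\mathcal Q_0=\mathcal Q_0^*\subset\mathcal Q^*$. $\langle\cdot,\cdot\rangle$ denotes the duality products. The forms $a:\mathcal V\times\mathcal V\to\mathbb R$, $k:\mathcal Q\times\mathcal Q\to\mathbb R$, $b:\mathcal V\times\mathcal Q_0\to\mathbb R$ are bilinear. Assumptions: (A1) $a$ is bounded, elliptic and symmetric. (A2) $k$ is bounded, elliptic and symmetric. (A3) $b$ is bounded and inf-sup stable: there are $C_b,\beta>0$ with $b(v,q)\le C_b\|v\|_{\mathcal V}\|q\|_{\mathcal Q_0}$ and $\sup_{\|v\|_{\mathcal V}=1}b(v,q)\ge\beta\|q\|_{\mathcal Q_0}$ for all $v\in\mathcal V$, $q\in\mathcal Q_0$. Norms: $\|v\|_{\mathcal V}^2=a(v,v)$, $\|q\|_{\mathcal Q}^2=k(q,q)$, and $\|q\|_{\mathcal Q_0}\le\|q\|_{\mathcal Q}$. $B:\mathcal V\to\mathcal Q_0^*$ is given by $\langle Bv,q\rangle=b(v,q)$. A dot denotes the time derivative. Continuous problem: $a(u(t),v)-b(v,p(t))=\langle f(t),v\rangle$ for all $v\in\mathcal V$, and $b(\dot u(t),q)+k(p(t),q)=\langle g(t),q\rangle$ for all $q\in\mathcal Q$, $0<t<T$, with data $f\in H^1(0,T;\mathcal V^* )$, $g\in L^2(0,T;\mathcal Q^*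 )$; the solution is assumed regular enough for all quantities to be defined ($u\in H^1(0,T;\mathcal V)$, $p\in H^1(0,T;\mathcal Q)$). $\mathcal V_h\subset\mathcal V$, $\mathcal Q_h\subset\mathcal Q$ are finite dimensional subspaces. Semi-discrete problem: $u_h\in H^1(0,T;\mathcal V_h)$, $p_h\in H^1(0,T;\mathcal Q_h)$ with $a(u_h(t),v_h)-b(v_h,p_h(t))=\langle f(t),v_h\rangle$ for all $v_h\in\mathcal V_h$, and $b(\dot u_h(t),q_h)+k(p_h(t),q_h)=\langle g(t),q_h\rangle$ for all $q_h\in\mathcal Q_h$. Elliptic projection: $\tilde u_h(t)\in\mathcal V_h$, $\tilde p_h(t)\in\mathcal Q_h$ are defined by $a(\tilde u_h(t)-u(t),v_h)-b(v_h,\tilde p_h(t)-p(t))=0$ for all $v_h\in\mathcal V_h$ and $k(\tilde p_h(t)-p(t),q_h)=0$ for all $q_h\in\mathcal Q_h$. *)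

(* Defs.v *)
From HB Require Import structures.
From mathcomp Require Import all_boot all_order all_algebra.
From mathcomp Require Import all_classical all_reals all_analysis.

Set Implicit Arguments.
Unset Strict Implicit.
Unset Printing Implicit Defensive.

Import Order.TTheory GRing.Theory Num.Theory.
Import numFieldNormedType.Exports.

Local Open Scope classical_set_scope.
Local Open Scope ring_scope.

(* On top of [completeNormedModType]: the norm comes from an inner product. *)
Definition is_hilbert (R : realType) (E : normedModType R) : Prop :=
  exists ip : {dot E for idfun}, forall x : E, ip x x = `|x| ^+ 2.

(* The norm of the dual space when phi is linear and continuous. *)
Definition dual_norm (R : realType) (E : normedModType R) (phi : E -> R) : R :=
  sup [set `|phi x| | x in [set x : E | `|x| <= 1]].

Section dual_space.
Context (R : realType) (E : normedModType R).

Definition dual_pred : pred (E -> R^o) :=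
  fun phi => `[< linear phi /\ continuous phi >].

Lemma dual_predP phi :
  reflect (linear phi /\ continuous phi) (phi \in dual_pred).
Proof. exact: asboolP. Qed.

Lemma dual_submod_closed : submod_closed dual_pred.
Proof.
split.
  apply/dual_predP; split; last exact: cst_continuous.
  by move=> l x y; rewrite /GRing.zero/= scaler0 addr0.
move=> c phi psi /dual_predP[lphi cphi] /dual_predP[lpsi cpsi].
apply/dual_predP; split.
  move=> l x y.
  rewrite -[LHS]/(c *: phi (l *: x + y) + psi (l *: x + y)).
  rewrite -[RHS]/(l *: (c *: phi x + psi x) + (c *: phi y + psi y)).
  by rewrite lphi lpsi !scalerDr !scalerA [l * c]mulrC addrACA.
move=> x.
rewrite -[_ + _]/(fun z => c *: phi z + psi z).
by apply: cvgD; [apply: cvgZr; exact: cphi|exact: cpsi].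
Qed.

HB.instance Definition _ :=
  GRing.isSubmodClosed.Build R (E -> R^o) dual_pred dual_submod_closed.

Record dual := Dual { dual_fun :> E -> R^o ; _ : dual_fun \in dual_pred }.

HB.instance Definition _ := [isSub for dual_fun].
HB.instance Definition _ := [Choice of dual by <:].
HB.instance Definition _ := [SubChoice_isSubLmodule of dual by <:].

Lemma dual_linear (f : dual) : linear f.
Proof. by case: f => f /= /dual_predP[]. Qed.

Lemma dual_continuous (f : dual) : continuous f.
Proof. by case: f => f /= /dual_predP[]. Qed.

Lemma dual0 (f : dual) : f 0 = 0.
Proof.
have := dual_linear f 1 0 0; rewrite !scale1r addr0.
by move=> /esym/eqP; rewrite -subr_eq0 addrK => /eqP.
Qed.

Lemma dualZ (f : dual) c x : f (c *: x) = c * f x.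
Proof. by have := dual_linear f c x 0; rewrite dual0 !addr0. Qed.

Lemma dual_has_sup (f : dual) :
  has_sup [set `|(f : E -> R) x| | x in [set x : E | `|x| <= 1]].
Proof.
split.
  by exists `|(f : E -> R) 0|; exists 0 => //=; rewrite normr0.
have /(@cvgrPdist_lt _ _ _ (nbhs (0 : E))) := @dual_continuous f 0.
move=> /(_ 1 ltr01)/nbhs_normP[e /= e0 fe].
exists (2 / e) => _ [x /= x1 <-].
have := fe ((e / 2) *: x) => /=.
have e2 : 0 < e / 2 by rewrite divr_gt0.
rewrite dual0 !sub0r !normrN normrZ dualZ (gtr0_norm e2) => h.
have {}h : `|e / 2 * (f x : R)| < 1.
  apply: h; apply: (@le_lt_trans _ _ (e / 2)).
    by rewrite ler_piMr// ltW.
  by rewrite gtr_pMr// invf_lt1// ltr1n.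
rewrite -[2 / e]invf_div -[leRHS]mulr1 ler_pdivlMl//.
by move: h; rewrite normrM (gtr0_norm e2) => /ltW.
Qed.

Lemma dual_norm_ubound (f : dual) x : `|x| <= 1 ->
  `|(f : E -> R) x| <= dual_norm f.
Proof.
move=> x1; apply: sup_upper_bound; first exact: dual_has_sup.
by exists x.
Qed.

Lemma dual_norm_ge0 (f : dual) : 0 <= dual_norm f.
Proof.
have /(dual_norm_ubound f) : `|0 : E| <= 1 by rewrite normr0.
by apply: le_trans; exact: normr_ge0.
Qed.

Lemma dual_norm_lub (f : dual) c :
  (forall x, `|x| <= 1 -> `|(f : E -> R) x| <= c) -> dual_norm f <= c.
Proof.
move=> h; apply: ge_sup; first by case: (dual_has_sup f).
by move=> _ [x /= x1 <-]; exact: h.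
Qed.

Let ler_dual_normD (f g : dual) :
  dual_norm (f + g : dual) <= dual_norm f + dual_norm g.
Proof.
apply: dual_norm_lub => x x1.
rewrite -[X in `|X| <= _]/(f x + g x : R).
by rewrite (le_trans (ler_normD _ _))// lerD// dual_norm_ubound.
Qed.

Let dual_normZ (c : R) (f : dual) :
  dual_norm (c *: f : dual) = `|c| * dual_norm f.
Proof.
have le1 d (g : dual) : dual_norm (d *: g : dual) <= `|d| * dual_norm g.
  apply: dual_norm_lub => x x1.
  rewrite -[X in `|X| <= _]/(d * g x : R) normrM ler_wpM2l//.
  exact: dual_norm_ubound.
apply/eqP; rewrite eq_le le1 andTb.
have [->|c0] := eqVneq c 0.
  by rewrite normr0 mul0r dual_norm_ge0.
rewrite -ler_pdivlMl ?normr_gt0//.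
rewrite -normfV; have := le1 c^-1 (c *: f : dual).
by rewrite scalerA mulVf// scale1r.
Qed.

Let dual_norm_eq0 (f : dual) : dual_norm f = 0 -> f = 0.
Proof.
move=> f0; apply/val_inj/funext => x /=.
rewrite -[RHS]/(0 : R).
have [->|x0] := eqVneq x 0; first exact: dual0.
have nx0 : `|x| != 0 by rewrite normr_eq0.
have : `|(f : E -> R) (`|x|^-1 *: x)| <= 0.
  rewrite -f0 dual_norm_ubound// normrZ normfV normr_id.
  by rewrite mulVf.
rewrite normr_le0 dualZ mulf_eq0 invr_eq0 (negbTE nx0)/=.
by move=> /eqP.
Qed.

HB.instance Definition _ := @Lmodule_isNormed.Build R dual
  (fun f => dual_norm f) ler_dual_normD dual_normZ dual_norm_eq0.

End dual_space.

(* The map sum_i 1_(sf_set i) sf_val i; the sets need not be disjoint. *)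
Record simple_fun (R : realType) (X : normedModType R) := SimpleFun {
  sf_size : nat ;
  sf_set : 'I_sf_size -> set R ;
  sf_val : 'I_sf_size -> X ;
  sf_measurable : forall i, measurable (sf_set i) }.

Definition sf_fun (R : realType) (X : normedModType R) (s : simple_fun X)
  (t : R) : X := \sum_(i < sf_size s) (\1_(sf_set i) t : R) *: sf_val i.

(* Meant for D of finite measure. *)
Definition sf_int (R : realType) (X : normedModType R) (D : set R)
    (s : simple_fun X) : X :=
  \sum_(i < sf_size s) fine (lebesgue_measure (D `&` sf_set i)) *: sf_val i.

Definition strongly_measurable (R : realType) (X : normedModType R)
    (D : set R) (f : R -> X) : Prop :=
  exists s : nat -> simple_fun X,
    {ae @lebesgue_measure R, forall t, D t -> sf_fun (s n) t @[n --> \oo] --> f t}.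

(* y is the Bochner integral of f over D. *)
Definition is_bochner (R : realType) (X : normedModType R) (D : set R)
    (f : R -> X) (y : X) : Prop :=
  strongly_measurable D f /\
  exists s : nat -> simple_fun X,
    (\int[@lebesgue_measure R]_(t in D) `|f t - sf_fun (s n) t|%:E)%E
      @[n --> \oo] --> 0%E /\
    sf_int D (s n) @[n --> \oo] --> y.

Definition L2 (R : realType) (X : normedModType R) (T : R) (f : R -> X) : Prop :=
  strongly_measurable `[0, T] f /\
  (\int[@lebesgue_measure R]_(t in `[0%R, T]) (`|f t| ^+ 2)%:E < +oo)%E.

(* H^1(0,T;X) consists of the primitives of functions of L^2(0,T;X); this fixes
   the continuous representative, so that point values on [0,T] make sense.
   The derivative w is determined only almost everywhere. *)
Definition is_time_derivative (R : realType) (X : normedModType R) (T : R)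
    (u w : R -> X) : Prop :=
  L2 T w /\ forall t, t \in `[0, T] -> is_bochner `[0, t] w (u t - u 0).

Definition H1 (R : realType) (X : normedModType R) (T : R) (u : R -> X) : Prop :=
  exists w, is_time_derivative T u w.

(* Some derivative of u if u is in H^1(0,T;X), and 0 otherwise. *)
Definition dt (R : realType) (X : normedModType R) (T : R) (u : R -> X) : R -> X :=
  xget (fun=> 0) [set w | is_time_derivative T u w].

Section forms.
Context (R : realType).

Definition form_bounded (U W : normedModType R) (c : U -> W -> R) : Prop :=
  exists C : R, forall u w, `|c u w| <= C * `|u| * `|w|.

Definition form_elliptic (U : normedModType R) (c : U -> U -> R) : Prop :=
  exists2 alpha : R, 0 < alpha & forall u, alpha * `|u| ^+ 2 <= c u u.

Definition form_symmetric (U : normedModType R) (c : U -> U -> R) : Prop :=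
  forall u w, c u w = c w u.

Definition energy_norm (U : normedModType R) (c : U -> U -> R) (u : U) : R :=
  Num.sqrt (c u u).

Definition compact_map (U W : normedModType R) (i : U -> W) : Prop :=
  forall A : set U, bounded_set A -> compact (closure (i @` A)).

Definition finite_dim_subspace (U : normedModType R) (A : set U) : Prop :=
  exists n (e : 'I_n -> U), A = range (fun c : 'I_n -> R => \sum_i c i *: e i).

End forms.

(* Q is not literally a subset of Q0: the embedding is the map i, and q in Q is
   i q when seen in Q0. *)
Section problem.
Context (R : realType) (V Q Q0 : normedModType R).
Implicit Types (i : Q -> Q0) (a : V -> V -> R) (k : Q -> Q -> R)
  (b : V -> Q0 -> R) (T : R).

(* Trial and test functions take their values in Vh and Qh; the continuous
   problem is the case Vh = setT, Qh = setT. *)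
Definition is_solution i a k b T (f : R -> dual V) (g : R -> dual Q)
    (Vh : set V) (Qh : set Q) (u : R -> V) (p : R -> Q) : Prop :=
  [/\ H1 T u /\ H1 T p,
      forall t, t \in `[0, T] -> Vh (u t) /\ Qh (p t),
      forall t, t \in `]0, T[ ->
        forall v, Vh v -> a (u t) v - b v (i (p t)) = f t v
    & {ae @lebesgue_measure R, forall t, t \in `]0, T[ ->
        forall q, Qh q -> b (dt T u t) (i q) + k (p t) q = g t q} ].

Definition is_elliptic_projection i a k b T (Vh : set V) (Qh : set Q)
    (u : R -> V) (p : R -> Q) (ut : R -> V) (pt : R -> Q) : Prop :=
  forall t, t \in `[0, T] ->
    [/\ Vh (ut t), Qh (pt t),
        forall v, Vh v -> a (ut t - u t) v - b v (i (pt t - p t)) = 0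
      & forall q, Qh q -> k (pt t - p t) q = 0].

(* sup over the v in Vh of energy norm 1 of b(v,q). *)
Definition sup_unit a b (Vh : set V) (q : Q0) : \bar R :=
  ereal_sup [set (b v q)%:E | v in [set v | Vh v /\ energy_norm a v = 1]].

End problem.

(* Main.v *)
Require Import Defs.
From mathcomp Require Import all_boot all_order all_algebra.
From mathcomp Require Import all_classical all_reals all_analysis.
From mathcomp Require Import measurable_realfun.
From mathcomp Require Import ring lra.

Set Implicit Arguments.
Unset Strict Implicit.
Unset Printing Implicit Defensive.

Import Order.TTheory GRing.Theory Num.Theory.
Import numFieldNormedType.Exports.

Local Open Scope classical_set_scope.
Local Open Scope ring_scope.

(** The error du = uh - ut, dp = ph - pt of the discrete solution against the
    elliptic projection satisfies two equations: the static one,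
    a(du, v) = b(v, dp) for discrete v, and the dynamic one,
    b(du', q) + k(dp, q) = b(u' - ut', q) for discrete q. Testing them with
    v = du' and q = dp and adding up gives
    a(du, du') + k(dp, dp) = b(u' - ut', dp), whose right-hand side is at most
    the product of the dual norm D of b(u' - ut', .) and the energy norm of dp.
    Hence 2 a(du, du') + k(dp, dp) <= D^2 ([error_power_le]), and integrating in
    time from du(0) = 0 gives the first estimate ([energy_estimate]). The second
    one ([pressure_error_le]) is the inf-sup condition together with the static
    equation and the Cauchy-Schwarz inequality.

    The work is in the time derivatives, which are integrands of Bochner
    integrals determined almost everywhere. Each derivative w has a
    representative that is a limit of simple functions everywhere
    ([borel_derivative_exists]), so that a bounded functional phi turns it into
    an integrable real function with primitive phi(u t) - phi(u 0)
    ([functional_primitive]). Three facts then follow from real analysis. First,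
    the derivative of a function with values in a discrete space lies in that
    space almost everywhere ([derivative_in_span]), which is what allows the
    choice v = du'. Second, a(du, du) is the primitive of 2 a(du, du')
    ([energy_primitive]); in an orthonormal basis this is the chain rule for the
    square of an absolutely continuous function ([primitive_sqr]). Third, the
    elliptic projection is a bounded linear image of the solution, so it has a
    time derivative at all ([elliptic_projection_H1]).

    The integrand D^2 need not be Borel, since derivatives are arbitrary on null
    sets; the final comparison of integrals only uses that the integral of a
    nonnegative function is monotone ([ae_le_lower_integral]). *)

(** * Primitives of integrable functions *)

Section primitives.
Context (R : realType).
Notation mu := (@lebesgue_measure R).

Lemma aeS (P Q : R -> Prop) : (forall t, P t -> Q t) ->
  {ae mu, forall t, P t} -> {ae mu, forall t, Q t}.
Proof. by move=> PQ; apply: (@filterS _ _ (ae_filter_ringOfSetsType mu)). Qed.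

Lemma aeI (P Q : R -> Prop) : {ae mu, forall t, P t} ->
  {ae mu, forall t, Q t} -> {ae mu, forall t, P t /\ Q t}.
Proof. exact: (@filterI _ _ (ae_filter_ringOfSetsType mu)). Qed.

Lemma in_segment_oo (T t : R) : t \in `]0, T[ -> t \in `[0, T].
Proof. by rewrite !in_itv/= => /andP[/ltW-> /ltW->]. Qed.

Lemma sub_segment0 (t T : R) : t <= T -> `[0, t] `<=` `[0, T].
Proof.
by move=> tT x /=; rewrite !in_itv/= => /andP[-> /le_trans]; exact.
Qed.

Lemma integrable_sub0 (h : R -> R) (t T : R) : t <= T ->
  mu.-integrable `[0, T] (EFin \o h) -> mu.-integrable `[0, t] (EFin \o h).
Proof. by move=> tT; apply: integrableS => //; exact: sub_segment0. Qed.

(** Halving [s, t] at a point where A takes the mean of its two end values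
    replaces the bound K (A t - A s)^2 by half of it; halving repeatedly, F has
    no increment at all. *)
Lemma quadratic_increments_const (T K : R) (F A : R -> R) :
  {within `[0, T], continuous A} ->
  (forall s t, 0 <= s -> s <= t -> t <= T ->
     `|F t - F s| <= K * (A t - A s) ^+ 2) ->
  forall t, t \in `[0, T] -> F t = F 0.
Proof.
move=> cA FA.
have halving n s t : 0 <= s -> s <= t -> t <= T ->
    `|F t - F s| <= K * (A t - A s) ^+ 2 / 2 ^+ n.
  elim: n s t => [|n IH] s t s0 st tT; first by rewrite expr0 divr1; exact: FA.
  have cAst : {within `[s, t], continuous A}.
    apply: continuous_subspaceW cA => x /=; rewrite !in_itv/= => /andP[sx xt].
    by rewrite (le_trans s0 sx) (le_trans xt tT).
  have [|m] := @IVT _ A s t ((A s + A t) / 2) st cAst.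
    by have [|] := leP (A s) (A t) => h; apply/andP; split; lra.
  rewrite in_itv/= => /andP[sm mt] Am.
  have Hm := IH s m s0 sm (le_trans mt tT).
  have Ht := IH m t (le_trans s0 sm) mt tT.
  rewrite (_ : F t - F s = (F t - F m) + (F m - F s)); last by ring.
  apply: le_trans (ler_normD _ _) _; apply: le_trans (lerD Ht Hm) _.
  rewrite Am [2 ^+ n.+1]exprS le_eqVlt; apply/orP; left; apply/eqP.
  by field; rewrite expf_neq0.
move=> t; rewrite in_itv/= => /andP[t0 tT].
apply/eqP; rewrite -subr_eq0 -normr_eq0 eq_le normr_ge0 andbT.
set c := K * (A t - A 0) ^+ 2.
have cvg0 : geometric c 2^-1 @ \oo --> (0 : R).
  by apply: cvg_geometric; rewrite gtr0_norm ?invr_gt0// invf_lt1// ltr1n.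
apply: (cvgr_to_ge cvg0); apply: nearW => n.
by rewrite /= exprVn; exact: halving.
Qed.

Definition primitive (h : R -> R) (t : R) : R := \int[mu]_(s in `[0, t]) h s.

Lemma primitive0 h : primitive h 0 = 0.
Proof. by rewrite /primitive set_itv1 Rintegral_set1. Qed.

Lemma primitive_continuous (h : R -> R) (T : R) : 0 <= T ->
  mu.-integrable `[0, T] (EFin \o h) ->
  {within `[0, T], continuous (primitive h)}.
Proof. by move=> T0 ih; exact: parameterized_integral_continuous. Qed.

Lemma primitiveB (h : R -> R) (s t : R) : 0 <= s -> s <= t ->
  mu.-integrable `[0, t] (EFin \o h) ->
  primitive h t - primitive h s = \int[mu]_(r in `]s, t]) h r.
Proof. by move=> s0 st ih; rewrite /primitive Rintegral_itvB. Qed.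

Lemma integrableZ (D : set (measurableTypeR R)) (r : R) (h : R -> R) : measurable D ->
  mu.-integrable D (EFin \o h) -> mu.-integrable D (EFin \o (fun s => r * h s)).
Proof.
move=> mD ih; have := integrableZl mD r ih.
by under eq_fun do rewrite -EFinM.
Qed.

Lemma integrable_add (D : set (measurableTypeR R)) (h g : R -> R) : measurable D ->
  mu.-integrable D (EFin \o h) -> mu.-integrable D (EFin \o g) ->
  mu.-integrable D (EFin \o (fun s => h s + g s)).
Proof.
move=> mD ih ig; have := integrableD mD ih ig.
by congr (mu.-integrable D _); apply/funext => x /=; rewrite EFinD.
Qed.

Lemma integrable_opp (D : set (measurableTypeR R)) (h : R -> R) :
  measurable D -> mu.-integrable D (EFin \o h) ->
  mu.-integrable D (EFin \o (fun s => - h s)).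
Proof.
move=> mD /(integrableZ (-1) mD).
by congr (mu.-integrable D _); apply/funext => x /=; rewrite mulN1r.
Qed.

Lemma integrable_continuousM (T : R) (c h : R -> R) :
  {within `[0, T], continuous c} ->
  mu.-integrable `[0, T] (EFin \o h) ->
  mu.-integrable `[0, T] (EFin \o (fun s => c s * h s)).
Proof.
move=> cc ih; apply: (integrableMr _ _ _ ih) => //.
  by apply: subspace_continuous_measurable_fun.
have /compact_bounded[M [_ mrt]] := continuous_compact cc (@segment_compact _ 0 T).
by exists M; split; rewrite ?num_real // => ? ? ? ?; exact: mrt.
Qed.

(** The chain rule for c^2, where c is only the primitive of an integrable h.
    With A the primitive of |h|, the values of c on [s, t] differ by at most
    A t - A s, so the increment of c^2 - 2 int c h over [s, t], which is the
    integral of (c t + c s - 2 c r) h r over r, is at most 2 (A t - A s)^2. *)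
Lemma primitive_sqr (T : R) (h : R -> R) : 0 <= T ->
  mu.-integrable `[0, T] (EFin \o h) ->
  forall t, t \in `[0, T] ->
    primitive h t ^+ 2 = 2 * \int[mu]_(s in `[0, t]) (primitive h s * h s).
Proof.
move=> T0 ih; set c := primitive h.
have cc : {within `[0, T], continuous c} by exact: primitive_continuous.
have ich := integrable_continuousM cc ih.
have inh := integrable_norm ih.
pose A := primitive (fun s => `|h s|).
pose F t := c t ^+ 2 - 2 * primitive (fun s => c s * h s) t.
suff F0 t : t \in `[0, T] -> F t = F 0.
  move=> t /F0/eqP; rewrite /F /c !primitive0 expr0n mulr0 subrr subr_eq0.
  by move/eqP.
apply: (@quadratic_increments_const T 2 F A); first exact: primitive_continuous.
move=> {t} s t s0 st tT.
have sub : `]s, t] `<=` `[0, T].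
  move=> x /=; rewrite !in_itv/= => /andP[sx xt].
  by rewrite (le_trans s0 (ltW sx)) (le_trans xt tT).
have ih' : mu.-integrable `]s, t] (EFin \o h) by exact: integrableS ih.
have inh' : mu.-integrable `]s, t] (EFin \o (fun x => `|h x|)).
  exact: integrableS inh.
have ich' : mu.-integrable `]s, t] (EFin \o (fun x => c x * h x)).
  exact: integrableS ich.
have AE : A t - A s = \int[mu]_(r in `]s, t]) `|h r|.
  by rewrite primitiveB//; exact: integrable_sub0 inh.
have cE : c t - c s = \int[mu]_(r in `]s, t]) h r.
  by rewrite primitiveB//; exact: integrable_sub0 ih.
have chE : primitive (fun s => c s * h s) t - primitive (fun s => c s * h s) s
    = \int[mu]_(r in `]s, t]) (c r * h r).
  by rewrite primitiveB//; exact: integrable_sub0 ich.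
have osc a b : s <= a -> a <= b -> b <= t -> `|c b - c a| <= A t - A s.
  move=> sa ab bt; have a0 := le_trans s0 sa; have b0 := le_trans a0 ab.
  have subab : `]a, b] `<=` `]s, t].
    move=> x /=; rewrite !in_itv/= => /andP[ax xb].
    by rewrite (le_lt_trans sa ax) (le_trans xb bt).
  rewrite /c primitiveB//; last exact: integrable_sub0 (integrable_sub0 tT ih).
  rewrite (le_trans (le_normr_Rintegral _ _))//; first exact: integrableS ih'.
  rewrite AE fine_le//.
  - by apply: integrable_fin_num => //; exact: integrableS inh'.
  - exact: integrable_fin_num.
  - by apply: ge0_subset_integral => //; exact: measurable_int inh'.
have -> : F t - F s = \int[mu]_(r in `]s, t]) ((c t + c s) * h r - 2 * (c r * h r)).
  rewrite RintegralB//; last 2 first.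
  - exact: integrableZ.
  - exact: integrableZ.
  rewrite !RintegralZl//; rewrite -cE -chE /F; ring.
have id : mu.-integrable `]s, t]
    (EFin \o (fun r => (c t + c s) * h r - 2 * (c r * h r))).
  apply: (@integrableB _ _ _ mu _ _ (fun r => ((c t + c s) * h r)%:E)
    (fun r => (2 * (c r * h r))%:E)) => //.
  - exact: integrableZ.
  - exact: integrableZ.
apply: le_trans (le_normr_Rintegral _ id) _ => //.
apply: (@le_trans _ _ (\int[mu]_(r in `]s, t]) ((2 * (A t - A s)) * `|h r|))).
  apply: le_Rintegral => //.
  - exact: integrable_norm id.
  - exact: integrableZ.
  - move=> r /=; rewrite in_itv/= => /andP[sr rt].
    rewrite (_ : _ - _ = ((c t - c r) - (c r - c s)) * h r); last by ring.
    rewrite normrM ler_wpM2r// (le_trans (ler_normB _ _))//.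
    by rewrite mulr2n mulrDl !mul1r lerD// osc// ltW.
by rewrite RintegralZl// -AE expr2 mulrA.
Qed.

(** By Lebesgue's differentiation theorem h is almost everywhere the derivative
    of its primitive. *)
Lemma primitive_eq0_ae (T : R) (h : R -> R) :
  mu.-integrable `[0, T] (EFin \o h) ->
  (forall t, t \in `[0, T] -> primitive h t = 0) ->
  {ae mu, forall t, t \in `]0, T[ -> h t = 0}.
Proof.
move=> ih h0; pose g := h \_ `[0, T].
have ig : mu.-integrable setT (EFin \o g).
  rewrite /g -restrict_EFin; apply/integrable_restrict => //.
  by rewrite setTI.
have loc : locally_integrable setT g by exact: integrable_locally.
have ig' y : mu.-integrable `[0, y] (EFin \o g) by exact: integrableS ig.
have := @FTC1 _ g (BLeft 0) ig' loc.
apply: aeS => t H; rewrite in_itv/= => /andP[t0 tT].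
have [|_] := H; first by rewrite ?lte_fin ?bnd_simp ?ltW.
rewrite [g t]patchE mem_set/= ?in_itv/= ?ltW// => <-.
rewrite derive1E -[RHS](@derive_cst _ R R 0 t 1).
apply: near_eq_derive; near=> x.
have xT : x < T by near: x; exact: lt_nbhsl.
have x0 : 0 < x by near: x; exact: lt_nbhsr.
transitivity (primitive h x); last by rewrite h0// in_itv/= !ltW.
apply: eq_Rintegral => y; rewrite inE => y0x; rewrite /g patchE mem_set//.
by apply: sub_segment0 y0x; exact: ltW.
Unshelve. all: by end_near. Qed.

End primitives.

(** * Integrals of nonnegative functions and step functions *)

Section lower_integral.
Context (R : realType).
Notation mu := (@lebesgue_measure R).

(** The integral of a nonnegative function is a supremum over the simple
    functions below it, so it is monotone even on functions that are not Borel. *)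
Lemma le_lower_integral (D : set (measurableTypeR R)) (f g : R -> \bar R) :
  (forall t, D t -> (0 <= f t)%E) -> (forall t, D t -> (f t <= g t)%E) ->
  (\int[mu]_(t in D) f t <= \int[mu]_(t in D) g t)%E.
Proof.
move=> f0 fg.
have g0 t : D t -> (0 <= g t)%E by move=> Dt; rewrite (le_trans (f0 t Dt))// fg.
rewrite !ge0_integralE//; apply: le_ereal_sup => _ [h /= hf <-].
exists h => // t; apply: le_trans (hf t) _.
by rewrite !patchE; case: ifPn => // /set_mem/fg.
Qed.

(** As g may fail to be Borel, the exceptional null set is dealt with on the side
    of f, whose positive part is cut to 0 there without changing its integral. *)
Lemma ae_le_lower_integral (D : set (measurableTypeR R)) (f g : R -> R) :
  measurable D -> mu.-integrable D (EFin \o f) -> (forall t, D t -> 0 <= g t) ->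
  {ae mu, forall t, D t -> f t <= g t} ->
  (\int[mu]_(t in D) (f t)%:E <= \int[mu]_(t in D) (g t)%:E)%E.
Proof.
move=> mD intf g0 [N [mN N0 fgN]].
have mf : measurable_fun D f by apply/measurable_EFinP; exact: (measurable_int mu intf).
pose f1 t := Num.max (f t) 0.
have mf1 : measurable_fun D f1 by exact: measurable_maxr.
pose f2 t : R := f1 t * \1_(~` N) t.
have mf2 : measurable_fun D f2.
  apply: measurable_funM => //.
  by apply: measurable_indic => //; exact: measurableC.
have f10 t : 0 <= f1 t by rewrite le_max lexx orbT.
have f20 t : 0 <= f2 t by rewrite mulr_ge0// indicE.
apply: (@le_trans _ _ (\int[mu]_(t in D) (f1 t)%:E)%E).
  apply: le_integral => //; last by move=> t _; rewrite lee_fin le_max lexx.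
  apply: le_integrable intf => //; first exact/measurable_EFinP.
  move=> t Dt; rewrite lee_fin ger0_norm// /f1.
  by rewrite ge_max ler_norm normr_ge0.
rewrite (_ : (\int[mu]_(t in D) (f1 t)%:E = \int[mu]_(t in D) (f2 t)%:E)%E).
  apply: le_lower_integral => t Dt; first by rewrite lee_fin.
  rewrite lee_fin /f2 indicE; case: (boolP (t \in _)); last by rewrite mulr0 g0.
  move=> /set_mem Nt; rewrite mulr1 ge_max g0// andbT.
  by move: Dt; apply: contrapT => ?; apply: Nt; exact: fgN.
apply: ge0_ae_eq_integral => //.
- exact/measurable_EFinP.
- exact/measurable_EFinP.
- by move=> t _; rewrite lee_fin.
- by move=> t _; rewrite lee_fin.
exists N; split => // t /= Nft; apply: contrapT => Nt; apply: Nft => _.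
by rewrite /f2 indicE mem_set// mulr1.
Qed.

End lower_integral.

Section simple_functions.
Context (R : realType) (X : normedModType R).
Notation mu := (@lebesgue_measure R).

(** The indicator of the first set selects one of two functions with one step
    fewer, whose offsets are x + v ord0 and x. *)
Lemma step_comp_measurable (phi : X -> R) n (A : 'I_n -> set R) (v : 'I_n -> X)
    (x : X) : (forall i, measurable (A i)) ->
  measurable_fun [set: measurableTypeR R]
    (fun t => phi (x + \sum_(i < n) (\1_(A i) t : R) *: v i)).
Proof.
elim: n A v x => [|n IH] A v x mA.
  by under eq_fun do rewrite big_ord0; exact: measurable_cst.
pose F y t := phi (y + \sum_(i < n) (\1_(A (lift ord0 i)) t : R) *: v (lift ord0 i)).
rewrite (_ : (fun t => _) =
    (fun t => if t \in A ord0 then F (x + v ord0) t else F x t)); last first.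
  apply/funext => t; rewrite /F big_ord_recl indicE.
  by case: ifPn => _; rewrite ?scale1r ?scale0r ?add0r// addrA.
apply: measurable_fun_ifT; [|exact: IH|exact: IH].
have AE : (fun t => t \in A ord0) @^-1` [set true] = A ord0.
  by apply/seteqP; split => t /=; [move/set_mem|move/mem_set].
by apply: (measurable_fun_bool true) => //; rewrite setTI AE; exact: mA.
Qed.

(** Strong measurability with convergence at every time instead of almost every
    time. With the almost everywhere version, phi \o w would only be equal to a
    Borel function almost everywhere. *)
Definition simple_limit (w : R -> X) : Prop :=
  exists s : nat -> simple_fun X, forall t, sf_fun (s n) t @[n --> \oo] --> w t.

Lemma simple_limit_measurable (w : R -> X) (phi : X -> R) :
  simple_limit w -> continuous phi ->
  measurable_fun [set: measurableTypeR R] (phi \o w).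
Proof.
move=> [s sw] cphi.
apply: (@measurable_fun_cvg _ _ _ _ (fun n t => phi (sf_fun (s n) t))).
  move=> n; have := @step_comp_measurable phi _ (sf_set (s := s n)) (@sf_val _ _ (s n)) 0.
  by under eq_fun do rewrite add0r; apply; exact: sf_measurable.
by move=> t _; apply: continuous_cvg (sw t); exact: cphi.
Qed.

Definition sf_restrict (G : set R) (mG : measurable G) (s : simple_fun X) :
    simple_fun X :=
  @SimpleFun R X (sf_size s) (fun i => sf_set i `&` G) (@sf_val _ _ s)
    (fun i => measurableI _ _ (sf_measurable i) mG).

Lemma sf_restrictE G mG s t :
  sf_fun (@sf_restrict G mG s) t = (\1_G t : R) *: sf_fun s t.
Proof.
rewrite /sf_fun scaler_sumr; apply: eq_bigr => i _.
by rewrite indicI scalerA mulrC.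
Qed.

Lemma sf_restrict_int (D G : set R) (mG : measurable G) s :
  measurable D -> mu (D `\` G) = 0%E -> sf_int D (sf_restrict mG s) = sf_int D s.
Proof.
move=> mD DG; apply: eq_bigr => i _; congr (fine _ *: _).
rewrite setIA [RHS](measureDI mu _ mG); last first.
  by apply: measurableI => //; exact: sf_measurable.
rewrite [X in (X + _)%E](_ : _ = 0%E) ?add0e//.
apply: (subset_measure0 _ _ _ DG).
- apply: measurableD => //; apply: measurableI => //; exact: sf_measurable.
- exact: measurableD.
- by move=> t [[]].
Qed.

End simple_functions.

(** * Bounded linear maps and Borel time derivatives *)

Section bounded_linear.
Context (R : realType).

Definition bounded_linear (X Y : normedModType R) (L : X -> Y) : Prop :=
  linear L /\ exists2 C, 0 <= C & forall x, `|L x| <= C * `|x|.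

Context (X Y : normedModType R) (L : X -> Y) (bL : bounded_linear L).

Lemma blinearD x y : L (x + y) = L x + L y.
Proof. by have := bL.1 1 x y; rewrite !scale1r. Qed.

Lemma blinear0 : L 0 = 0.
Proof. by apply: (@addrI _ (L 0)); rewrite -blinearD !addr0. Qed.

Lemma blinearZ c x : L (c *: x) = c *: L x.
Proof. by have := bL.1 c x 0; rewrite blinear0 !addr0. Qed.

Lemma blinearB x y : L (x - y) = L x - L y.
Proof. by rewrite blinearD -scaleN1r blinearZ scaleN1r. Qed.

Lemma blinear_sum n (F : 'I_n -> X) : L (\sum_i F i) = \sum_i L (F i).
Proof. exact: (big_morph L blinearD blinear0). Qed.

Lemma blinear_continuous : continuous L.
Proof.
have [C C0 LC] := bL.2.
move=> x; apply/cvgrPdist_lt => e e0.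
have C1 : 0 < C + 1 by rewrite ltr_wpDl.
near=> y; rewrite -blinearB (le_lt_trans (LC _))//.
apply: (@le_lt_trans _ _ ((C + 1) * `|x - y|)).
  by rewrite ler_wpM2r// lerDl.
rewrite -ltr_pdivlMl//; near: y.
by apply: cvgr_dist_lt => //; rewrite mulr_gt0// invr_gt0.
Unshelve. all: by end_near. Qed.

Lemma blinear_cvg (f : nat -> X) (x : X) :
  f n @[n --> \oo] --> x -> L (f n) @[n --> \oo] --> L x.
Proof. by move=> fx; apply: continuous_cvg fx; exact: blinear_continuous. Qed.

End bounded_linear.

Section simple_function_operations.
Context (R : realType).
Notation mu := (@lebesgue_measure R).

Definition sf_map (X Y : normedModType R) (L : X -> Y) (s : simple_fun X) :
    simple_fun Y :=
  @SimpleFun R Y (sf_size s) (@sf_set _ _ s) (fun i => L (sf_val i))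
    (@sf_measurable _ _ s).

Lemma sf_mapE (X Y : normedModType R) (L : X -> Y) s t : bounded_linear L ->
  sf_fun (sf_map L s) t = L (sf_fun s t).
Proof.
move=> bL; rewrite /sf_fun (blinear_sum bL); apply: eq_bigr => i _.
by rewrite (blinearZ bL).
Qed.

Lemma sf_map_int (X Y : normedModType R) (L : X -> Y) s D : bounded_linear L ->
  sf_int D (sf_map L s) = L (sf_int D s).
Proof.
move=> bL; rewrite /sf_int (blinear_sum bL); apply: eq_bigr => i _.
by rewrite (blinearZ bL).
Qed.

Context (X : normedModType R).

Definition split_fun (A : Type) n m (f : 'I_n -> A) (g : 'I_m -> A)
    (i : 'I_(n + m)) : A :=
  match fintype.split i with inl j => f j | inr j => g j end.

Lemma split_fun_measurable n m (f : 'I_n -> set R) (g : 'I_m -> set R) :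
  (forall i, measurable (f i)) -> (forall i, measurable (g i)) ->
  forall i, measurable (split_fun f g i).
Proof. by move=> mf mg i; rewrite /split_fun; case: (fintype.split i). Qed.

Definition sf_add (s r : simple_fun X) : simple_fun X :=
  SimpleFun (split_fun (@sf_val _ _ s) (@sf_val _ _ r))
    (split_fun_measurable (@sf_measurable _ _ s) (@sf_measurable _ _ r)).

(** Both the values and the integral of a simple function are sums of this form. *)
Lemma sum_sf_add (s r : simple_fun X) (F : set R -> X -> X) :
  \sum_(i < sf_size (sf_add s r)) F (sf_set i) (sf_val i) =
  \sum_(i < sf_size s) F (sf_set i) (sf_val i) +
  \sum_(i < sf_size r) F (sf_set i) (sf_val i).
Proof.
rewrite big_split_ord/=; congr (_ + _); apply: eq_bigr => i _.
  by rewrite /split_fun (unsplitK (inl i)).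
by rewrite /split_fun (unsplitK (inr i)).
Qed.

Lemma sf_addE s r t : sf_fun (sf_add s r) t = sf_fun s t + sf_fun r t.
Proof. exact: (sum_sf_add s r (fun A x => (\1_A t : R) *: x)). Qed.

Lemma sf_add_int s r D : sf_int D (sf_add s r) = sf_int D s + sf_int D r.
Proof.
exact: (sum_sf_add s r (fun A x => fine (mu (D `&` A)) *: x)).
Qed.

Lemma simple_limit_sf (s : simple_fun X) : simple_limit (sf_fun s).
Proof. by exists (fun=> s) => t; exact: cvg_cst. Qed.

Lemma simple_limitD (w z : R -> X) : simple_limit w -> simple_limit z ->
  simple_limit (fun t => w t + z t).
Proof.
move=> [s sw] [r rz]; exists (fun n => sf_add (s n) (r n)) => t.
by under eq_fun do rewrite sf_addE; exact: cvgD.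
Qed.

Lemma simple_limit_map (Y : normedModType R) (L : X -> Y) (w : R -> X) :
  bounded_linear L -> simple_limit w -> simple_limit (L \o w).
Proof.
move=> bL [s sw]; exists (fun n => sf_map L (s n)) => t.
under eq_fun do rewrite sf_mapE//.
exact: (blinear_cvg bL (sw t)).
Qed.

Lemma simple_limit_measurable_norm (D : set (measurableTypeR R)) (w : R -> X) :
  simple_limit w -> measurable_fun D (fun t => `|w t|).
Proof.
move=> sw; apply: (@measurable_funS _ _ _ _ setT) => //.
exact: (simple_limit_measurable sw (@norm_continuous _ _)).
Qed.

End simple_function_operations.

Lemma scale_blinear (R : realType) (X : normedModType R) (c : R) :
  bounded_linear (fun x : X => c *: x).
Proof.
split; first by move=> a x y; rewrite scalerDr !scalerA mulrC.
by exists `|c| => // x; rewrite normrZ.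
Qed.

Lemma simple_limitB (R : realType) (X : normedModType R) (w z : R -> X) :
  simple_limit w -> simple_limit z -> simple_limit (fun t => w t - z t).
Proof.
move=> sw sz; have := simple_limitD sw (simple_limit_map (scale_blinear _ (-1)) sz).
by under eq_fun do rewrite /= scaleN1r.
Qed.

Section borel_derivatives.
Context (R : realType).
Notation mu := (@lebesgue_measure R).

(** A time derivative together with enough regularity to be handled by Borel
    functions only; each time derivative has such a representative. *)
Definition borel_derivative (X : normedModType R) (T : R) (u w : R -> X) : Prop :=
  [/\ simple_limit w,
      mu.-integrable `[0, T] (EFin \o (fun t => `|w t| ^+ 2))
    & forall t, t \in `[0, T] -> exists s : nat -> simple_fun X,
       (\int[mu]_(r in `[0%R, t]) `|w r - sf_fun (s n) r|%:E)%E
          @[n --> \oo] --> 0%E /\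
       sf_int `[0, t] (s n) @[n --> \oo] --> u t - u 0].

Lemma borel_derivative_time (X : normedModType R) (T : R) (u w : R -> X) :
  borel_derivative T u w -> is_time_derivative T u w.
Proof.
move=> [[s sw] w2 bw].
have sm D : strongly_measurable D w by exists s; apply: aeW => t _.
split; last by move=> t /bw.
split=> //; move/integrableP : w2 => [_].
by under eq_integral do rewrite /= ger0_norm ?exprn_ge0//.
Qed.

(** The representative is w cut to 0 outside [0, T] and on the null set N where
    the approximations of w do not converge. Cutting the simple functions in the
    same way can only decrease distances, and it does not change their integrals. *)
Lemma borel_derivative_exists (X : normedModType R) (T : R) (u w : R -> X) :
  is_time_derivative T u w -> exists2 w', borel_derivative T u w' &
    {ae mu, forall t, t \in `[0, T] -> w' t = w t}.
Proof.
move=> [[[s [N [mN N0 sN]]] w2] bw].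
pose G := `[0, T] `\` N.
have mG : measurable G by exact: measurableD.
pose w' t := (\1_G t : R) *: w t.
have sw' : simple_limit w'.
  exists (fun n => sf_restrict mG (s n)) => t; rewrite /w'.
  under eq_fun do rewrite sf_restrictE.
  rewrite indicE; case: (boolP (t \in G)) => [/set_mem[tT Nt]|_].
    under eq_fun do rewrite scale1r.
    by rewrite scale1r; move: tT; apply: contrapT => h; apply: Nt; exact: sN.
  by under eq_fun do rewrite scale0r; rewrite scale0r; exact: cvg_cst.
have w'le t : `|w' t| <= `|w t|.
  rewrite /w' indicE; case: (t \in G); first by rewrite scale1r.
  by rewrite scale0r normr0.
exists w'.
  split => //.
  - apply/integrableP; split.
      apply/measurable_EFinP; apply: measurable_funX.
      exact: simple_limit_measurable_norm.
    under eq_integral do rewrite /= ger0_norm ?exprn_ge0//.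
    apply: le_lt_trans w2; apply: le_lower_integral => t _.
      by rewrite lee_fin exprn_ge0.
    by rewrite lee_fin ler_pXn2r// nnegrE.
  - move=> t tT; have [_ [r [rw rint]]] := bw t tT.
    exists (fun n => sf_restrict mG (r n)); split.
      apply: (squeeze_cvge _ (cvg_cst 0%E) rw); apply: nearW => n.
      rewrite integral_ge0//= le_lower_integral// => x _.
      rewrite sf_restrictE /w' -scalerBr normrZ lee_fin ler_piMl//.
      by rewrite indicE; case: (_ \in _); rewrite ?normr1// normr0.
    have tG : mu (`[0, t] `\` G) = 0%E.
      apply: (subset_measure0 _ _ _ N0) => //; first exact: measurableD.
      move=> x [xt /not_andP[|/contrapT//]] []; apply: sub_segment0 xt.
      by move: tT; rewrite in_itv/= => /andP[].
    have E n : sf_int `[0, t] (sf_restrict mG (r n)) = sf_int `[0, t] (r n).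
      by rewrite sf_restrict_int.
    by under eq_fun do rewrite E; exact: rint.
exists N; split => // t /= h; apply: contrapT => Nt; apply: h => tT.
by rewrite /w' indicE mem_set ?scale1r.
Qed.

Lemma borel_derivative_map (X Y : normedModType R) (L : X -> Y) (T : R)
    (u w : R -> X) : bounded_linear L ->
  borel_derivative T u w -> borel_derivative T (L \o u) (L \o w).
Proof.
move=> bL [sw w2 bw]; have [C C0 LC] := bL.2.
have sLw := simple_limit_map bL sw.
split => //.
- apply: (@le_integrable _ _ _ mu _ _ _ (EFin \o (fun t => C ^+ 2 * `|w t| ^+ 2))) => //.
  + apply/measurable_EFinP; apply: measurable_funX.
    exact: simple_limit_measurable_norm.
  + move=> t _ /=; rewrite lee_fin !ger0_norm ?mulr_ge0 ?exprn_ge0//.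
    by rewrite -exprMn ler_pXn2r// nnegrE// mulr_ge0.
  + exact: integrableZ.
- move=> t /bw[s [s0 sint]]; exists (fun n => sf_map L (s n)); split.
    have m0 n : measurable_fun (`[0, t] : set (measurableTypeR R))
        (fun r => `|w r - sf_fun (s n) r|).
      apply: simple_limit_measurable_norm.
      by apply: simple_limitB => //; exact: simple_limit_sf.
    have Cs0 : (C%:E * \int[mu]_(r in `[0%R, t]) `|w r - sf_fun (s n) r|%:E)%E
        @[n --> \oo] --> 0%E.
      by rewrite -(mule0 C%:E); apply: cvgeZl.
    apply: (squeeze_cvge _ (cvg_cst 0%E) Cs0); apply: nearW => n.
    rewrite integral_ge0//= -ge0_integralZl//; last exact/measurable_EFinP.
    apply: le_lower_integral => r _; first by rewrite lee_fin.
    by rewrite sf_mapE// -blinearB// -EFinM lee_fin LC.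
  under eq_fun do rewrite sf_map_int//.
  by rewrite /= -blinearB//; exact: (blinear_cvg bL sint).
Qed.

Lemma borel_derivativeD (X : normedModType R) (T : R) (u w v z : R -> X) :
  borel_derivative T u w -> borel_derivative T v z ->
  borel_derivative T (fun t => u t + v t) (fun t => w t + z t).
Proof.
move=> [sw w2 bw] [sz z2 bz]; have swz := simple_limitD sw sz.
split => //.
- apply: (@le_integrable _ _ _ mu _ _ _
      (EFin \o (fun t => 2 * `|w t| ^+ 2 + 2 * `|z t| ^+ 2))) => //.
  + apply/measurable_EFinP; apply: measurable_funX.
    exact: simple_limit_measurable_norm.
  + move=> t _ /=; rewrite lee_fin !ger0_norm ?addr_ge0 ?mulr_ge0 ?exprn_ge0//.
    apply: (@le_trans _ _ ((`|w t| + `|z t|) ^+ 2)).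
      by rewrite ler_pXn2r ?nnegrE ?addr_ge0 ?ler_normD.
    by have := sqr_ge0 (`|w t| - `|z t|); nra.
  + by apply: integrable_add => //; exact: integrableZ.
- move=> t tT; have [s [s0 sint]] := bw t tT; have [r [r0 rint]] := bz t tT.
  exists (fun n => sf_add (s n) (r n)); split.
    have m0 n : measurable_fun (`[0, t] : set (measurableTypeR R))
        (fun x => `|w x - sf_fun (s n) x|).
      apply: simple_limit_measurable_norm.
      by apply: simple_limitB => //; exact: simple_limit_sf.
    have m1 n : measurable_fun (`[0, t] : set (measurableTypeR R))
        (fun x => `|z x - sf_fun (r n) x|).
      apply: simple_limit_measurable_norm.
      by apply: simple_limitB => //; exact: simple_limit_sf.
    have sr0 : (\int[mu]_(x in `[0%R, t]) `|w x - sf_fun (s n) x|%:E +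
        \int[mu]_(x in `[0%R, t]) `|z x - sf_fun (r n) x|%:E)%E
        @[n --> \oo] --> 0%E.
      by rewrite -[X in _ --> X]adde0; apply: cvgeD.
    apply: (squeeze_cvge _ (cvg_cst 0%E) sr0); apply: nearW => n.
    rewrite integral_ge0//= -ge0_integralD//; [|exact/measurable_EFinP..].
    apply: le_lower_integral => x _; first by rewrite lee_fin.
    by rewrite sf_addE -EFinD lee_fin opprD addrACA ler_normD.
  under eq_fun do rewrite sf_add_int.
  by rewrite opprD addrACA; exact: cvgD.
Qed.

Lemma borel_derivativeB (X : normedModType R) (T : R) (u w v z : R -> X) :
  borel_derivative T u w -> borel_derivative T v z ->
  borel_derivative T (fun t => u t - v t) (fun t => w t - z t).
Proof.
move=> uw /(borel_derivative_map (scale_blinear _ (-1)))/(borel_derivativeD uw).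
by rewrite /comp; under eq_fun do rewrite scaleN1r;
  under [X in borel_derivative _ _ X]eq_fun do rewrite scaleN1r.
Qed.

Lemma borel_derivative_eq (X : normedModType R) (T : R) (u v w : R -> X) :
  0 <= T -> (forall t, t \in `[0, T] -> u t = v t) ->
  borel_derivative T u w -> borel_derivative T v w.
Proof.
move=> T0 uv [sw w2 bw]; split => // t tT; have [s [s0 sint]] := bw t tT.
by exists s; split => //; rewrite -!uv// in_itv/= lexx T0.
Qed.

End borel_derivatives.

(** * Scalar derivatives and their primitives *)

Section weak_derivatives.
Context (R : realType).
Notation mu := (@lebesgue_measure R).

Lemma integrable_sum_ord (D : set (measurableTypeR R)) n (f : 'I_n -> R -> R) :
  measurable D -> (forall i, mu.-integrable D (EFin \o f i)) ->
  mu.-integrable D (EFin \o (fun t => \sum_(i < n) f i t)).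
Proof.
move=> mD; elim: n f => [|n IH] f intf.
  rewrite (_ : _ \o _ = cst 0%E); first exact: integrable0.
  by apply/funext => t /=; rewrite big_ord0.
rewrite (_ : _ \o _ =
    EFin \o (fun t => f ord0 t + \sum_(i < n) f (lift ord0 i) t)).
  by apply: integrable_add => //; exact: IH.
by apply/funext => t /=; rewrite big_ord_recl.
Qed.

Lemma Rintegral_sum_ord (D : set (measurableTypeR R)) n (f : 'I_n -> R -> R) :
  measurable D -> (forall i, mu.-integrable D (EFin \o f i)) ->
  \int[mu]_(t in D) (\sum_(i < n) f i t) = \sum_(i < n) \int[mu]_(t in D) f i t.
Proof.
move=> mD; elim: n f => [|n IH] f intf.
  under eq_Rintegral do rewrite big_ord0.
  by rewrite big_ord0 Rintegral_cst// mul0r.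
under eq_Rintegral do rewrite big_ord_recl.
rewrite RintegralD//; last exact: integrable_sum_ord.
by rewrite big_ord_recl IH.
Qed.

Lemma segment_finite_measure (t : R) : (mu `[0%R, t] < +oo)%E.
Proof. by rewrite lebesgue_measure_itv/=; case: ifP => _; rewrite ?ltry. Qed.

Lemma indic_integrable (A : set R) (t : R) : measurable A ->
  mu.-integrable `[0, t] (EFin \o (fun x => \1_A x)).
Proof.
move=> mA; apply: measurable_bounded_integrable => //.
- exact: segment_finite_measure.
- by apply: measurable_indic.
- exists 1; split => // M M1 x _ /=; rewrite indicE (le_trans _ (ltW M1))//.
  by case: (_ \in _); rewrite ?normr1// normr0.
Qed.

Lemma sf_fun_sum (s : simple_fun R^o) :
  sf_fun s = (fun x =>
    \sum_(i < sf_size s) (@sf_val R R^o s i : R) * \1_(@sf_set R R^o s i) x).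
Proof.
apply/funext => x; apply: eq_bigr => i _; exact: mulrC.
Qed.

Lemma sf_fun_integrable (s : simple_fun R^o) (t : R) :
  mu.-integrable `[0, t] (EFin \o (sf_fun s : R -> R)).
Proof.
rewrite sf_fun_sum; apply: integrable_sum_ord => // i.
by apply/integrableZ/indic_integrable => //; exact: sf_measurable.
Qed.

Lemma sf_int_Rintegral (s : simple_fun R^o) (t : R) :
  sf_int `[0, t] s = \int[mu]_(r in `[0, t]) (sf_fun s r : R).
Proof.
have i1 j : mu.-integrable `[0, t] (EFin \o (fun x => \1_(sf_set (s := s) j) x)).
  by apply: indic_integrable; exact: sf_measurable.
rewrite sf_fun_sum Rintegral_sum_ord//; last by move=> j; exact: integrableZ.
apply: eq_bigr => j _; rewrite RintegralZl//.
rewrite /Rintegral integral_indic//; last exact: sf_measurable.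
by rewrite setIC; exact: mulrC.
Qed.

(** |w| <= 1 + |w|^2. *)
Lemma borel_derivative_integrable (T : R) (u w : R -> R^o) :
  borel_derivative T u w -> mu.-integrable `[0, T] (EFin \o (w : R -> R)).
Proof.
move=> [sw w2 _].
apply: (@le_integrable _ _ _ mu _ _ _ (EFin \o (fun t => 1 + `|w t| ^+ 2))) => //.
- apply/measurable_EFinP; apply: (@measurable_funS _ _ _ _ setT) => //.
  by apply: (simple_limit_measurable (phi := id) sw) => x; exact: cvg_id.
- move=> t _ /=; rewrite lee_fin [leRHS]ger0_norm ?addr_ge0 ?exprn_ge0//.
  by have := sqr_ge0 (`|w t| - 1); have := normr_ge0 (w t); nra.
- apply: integrable_add => //.
  apply: measurable_bounded_integrable => //.
    exact: segment_finite_measure.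
  by exists 1; split => // M M1 x _ /=; rewrite normr1 ltW.
Qed.

(** Over [0, t], the integrals of the approximating simple functions tend to that
    of w, because the L^1 distances to w tend to 0, and to u t - u 0. *)
Lemma borel_derivative_primitive (T : R) (u w : R -> R^o) :
  borel_derivative T u w ->
  forall t, t \in `[0, T] -> u t - u 0 = primitive w t.
Proof.
move=> bw t tT; have iwT := borel_derivative_integrable bw.
have iw : mu.-integrable `[0, t] (EFin \o (w : R -> R)).
  by apply: integrable_sub0 iwT; move: tT; rewrite in_itv/= => /andP[].
have [_ _ /(_ _ tT)[s [s0 sint]]] := bw.
apply: (cvg_unique (@norm_hausdorff _ R^o) sint).
have d0 : `|sf_int `[0, t] (s n) - primitive w t|%:E @[n --> \oo] --> 0%E.
  apply: (squeeze_cvge _ (cvg_cst 0%E) s0); apply: nearW => n.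
  rewrite lee_fin normr_ge0/= distrC sf_int_Rintegral /primitive.
  have is_ := sf_fun_integrable (s n) t.
  have id : mu.-integrable `[0, t] (EFin \o (fun x => w x - sf_fun (s n) x : R)).
    by apply: integrable_add => //; exact: integrable_opp.
  rewrite -RintegralB// EFin_normr_Rintegral//.
  by apply: le_abse_integral => //; exact: (measurable_int mu id).
move/fine_cvgP : d0 => [_ /norm_cvg0P].
by move/subr_cvg0.
Qed.

End weak_derivatives.

(** * Orthonormal bases of finite dimensional subspaces *)

Section span.
Context (R : realType) (X : normedModType R).

Definition spanned n (e : 'I_n -> X) : set X :=
  range (fun c : 'I_n -> R => \sum_i c i *: e i).

Lemma spannedD n (e : 'I_n -> X) x y :
  spanned e x -> spanned e y -> spanned e (x + y).
Proof.
move=> [c _ <-] [d _ <-]; exists (fun i => c i + d i) => //.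
by rewrite -big_split; apply: eq_bigr => i _; rewrite scalerDl.
Qed.

Lemma spannedZ n (e : 'I_n -> X) r x : spanned e x -> spanned e (r *: x).
Proof.
move=> [c _ <-]; exists (fun i => r * c i) => //.
by rewrite scaler_sumr; apply: eq_bigr => i _; rewrite scalerA.
Qed.

Lemma spannedB n (e : 'I_n -> X) x y :
  spanned e x -> spanned e y -> spanned e (x - y).
Proof. by move=> ex ey; rewrite -scaleN1r; apply/spannedD/spannedZ. Qed.

(** The induction step for spans, in a form that leaves the coefficient of the
    first vector explicit. *)
Lemma spanned_cons n (e : 'I_n.+1 -> X) x :
  spanned e x <-> exists r, spanned (fun i => e (lift ord0 i)) (x - r *: e ord0).
Proof.
split=> [[c _ <-]|[r [c _ cE]]].
  exists (c ord0), (fun i => c (lift ord0 i)) => //.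
  by rewrite big_ord_recl addrC addKr.
exists (fun i => if unlift ord0 i is Some j then c j else r) => //.
rewrite big_ord_recl unlift_none -[RHS](subrK (r *: e ord0)) addrC -cE.
by congr (_ + _); apply: eq_bigr => i _; rewrite liftK.
Qed.

End span.

Section orthonormal_basis.
Context (R : realType) (X : normedModType R).
Context (c : {bilinear X -> X -> R | *%R & *%R}).
Hypothesis c_sym : form_symmetric c.
Hypothesis c_pos : forall x, x != 0 -> 0 < c x x.

Definition orthonormal_family n (e : 'I_n -> X) : Prop :=
  forall i j, c (e i) (e j) = (i == j)%:R.

Definition orthoproj n (e : 'I_n -> X) (x : X) : X := \sum_i c x (e i) *: e i.

Lemma orthoproj_in n (e : 'I_n -> X) x : spanned e (orthoproj e x).
Proof. by exists (fun i => c x (e i)). Qed.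

Lemma orthonormal_coord n (e : 'I_n -> X) (r : 'I_n -> R) j : orthonormal_family e ->
  c (\sum_i r i *: e i) (e j) = r j.
Proof.
move=> oe; rewrite linear_sumlz (bigD1 j)//= linearZl_LR oe eqxx mulr1.
rewrite big1 ?addr0// => i ij.
by rewrite linearZl_LR oe (negbTE ij) mulr0.
Qed.

Lemma orthoproj_id n (e : 'I_n -> X) x : orthonormal_family e -> spanned e x ->
  orthoproj e x = x.
Proof.
move=> oe [r _ <-]; apply: eq_bigr => i _.
by rewrite orthonormal_coord.
Qed.

Lemma orthoproj_perp n (e : 'I_n -> X) x v : orthonormal_family e -> spanned e v ->
  c v (x - orthoproj e x) = 0.
Proof.
move=> oe [r _ <-]; rewrite linear_sumlz big1// => i _.
rewrite linearZl_LR linearBr [c _ (orthoproj _ _)]c_sym orthonormal_coord//.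
by rewrite c_sym subrr mulr0.
Qed.

Lemma parseval n (e : 'I_n -> X) x y : orthonormal_family e -> spanned e x ->
  c x y = \sum_i c x (e i) * c y (e i).
Proof.
move=> oe ex; rewrite -{1}(orthoproj_id oe ex) linear_sumlz.
by apply: eq_bigr => i _; rewrite linearZl_LR [c _ y]c_sym.
Qed.

Lemma form_eq_in n (e : 'I_n -> X) x y : spanned e x -> spanned e y ->
  (forall v, spanned e v -> c x v = c y v) -> x = y.
Proof.
move=> ex ey xy; apply/eqP; rewrite -subr_eq0; apply/negPn/negP => /c_pos.
by rewrite linearBl xy ?subrr ?ltxx//; exact: spannedB.
Qed.

(** Gram-Schmidt: the component r of the first vector orthogonal to the others is
    normalized and added to their basis, unless it vanishes. *)
Lemma orthonormal_basis_exists n (e : 'I_n -> X) :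
  exists m (f : 'I_m -> X), orthonormal_family f /\ spanned f = spanned e.
Proof.
elim: n e => [e|n IH e]; first by exists 0%N, e; split => // -[].
have [m [f [of_ fE]]] := IH (fun i => e (lift ord0 i)).
pose r := e ord0 - orthoproj f (e ord0).
have eE x : spanned e x <-> exists a, spanned f (x - a *: r).
  rewrite spanned_cons -fE; split=> -[a ax]; exists a.
    rewrite /r scalerBr opprB addrCA addrC; apply: spannedD => //.
    exact/spannedZ/orthoproj_in.
  rewrite (_ : _ - _ = (x - a *: r) - a *: orthoproj f (e ord0)).
    by apply: spannedB => //; exact/spannedZ/orthoproj_in.
  by rewrite /r scalerBr opprB addrA addrAC addrK.
have [r0|r0] := eqVneq r 0.
  exists m, f; split => //; apply/seteqP; split => x.
    by move=> fx; apply/eE; exists 0; rewrite scale0r subr0.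
  by move=> /eE[a]; rewrite r0 scaler0 subr0.
have crr := c_pos r0; pose s := Num.sqrt (c r r).
have s0 : s != 0 by rewrite sqrtr_eq0 -ltNge.
have ss : s * s = c r r by rewrite -expr2 sqr_sqrtr// ltW.
have rf j : c r (f j) = 0.
  by rewrite c_sym orthoproj_perp// -(orthoproj_id (x := f j) of_);
    [exact: orthoproj_in|exists (fun i => (i == j)%:R) => //;
     rewrite (bigD1 j)//= eqxx scale1r big1 ?addr0// => i /negbTE->;
     rewrite scale0r].
pose g i := if unlift ord0 i is Some j then f j else s^-1 *: r.
have g0 : g ord0 = s^-1 *: r by rewrite /g unlift_none.
have gS j : g (lift ord0 j) = f j by rewrite /g liftK.
exists m.+1, g; split.
  move=> i j; case: (unliftP ord0 i) => [i'|] ->; case: (unliftP ord0 j) => [j'|] ->.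
  - by rewrite !gS of_ (inj_eq lift_inj).
  - by rewrite gS g0 linearZr_LR c_sym rf mulr0 eq_sym (negbTE (neq_lift _ _)).
  - by rewrite gS g0 linearZl_LR rf mulr0 (negbTE (neq_lift _ _)).
  - by rewrite g0 linearZl_LR linearZr_LR -ss eqxx mulr1n; field.
apply/seteqP; split => x.
  move=> /spanned_cons[a]; rewrite g0 scalerA => h; apply/eE; exists (a * s^-1).
  by move: h; congr (spanned _ _); apply/funext.
move=> /eE[a ax]; apply/spanned_cons; exists (a * s).
rewrite g0 scalerA mulfK//; move: ax; congr (spanned _ _); apply/funext => j.
by rewrite gS.
Qed.

End orthonormal_basis.

(** * Derivatives tested with bounded functionals *)

Section bounded_linear_constructions.
Context (R : realType).
Implicit Types X Y Z : normedModType R.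

Lemma blinear_comp X Y Z (L : X -> Y) (M : Y -> Z) :
  bounded_linear L -> bounded_linear M -> bounded_linear (M \o L).
Proof.
move=> bL bM; split.
  by move=> a x y /=; rewrite (blinearD bL) (blinearZ bL) (blinearD bM) (blinearZ bM).
have [C C0 LC] := bL.2; have [D D0 MD] := bM.2.
exists (D * C) => [|x /=]; first exact: mulr_ge0.
by rewrite (le_trans (MD _))// -mulrA ler_wpM2l.
Qed.

Lemma blinear_add X Y (L M : X -> Y) : bounded_linear L -> bounded_linear M ->
  bounded_linear (fun x => L x + M x).
Proof.
move=> bL bM; split.
  move=> a x y; rewrite (blinearD bL) (blinearZ bL) (blinearD bM) (blinearZ bM).
  by rewrite scalerDr addrACA.
have [C C0 LC] := bL.2; have [D D0 MD] := bM.2.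
exists (C + D) => [|x /=]; first exact: addr_ge0.
by rewrite (le_trans (ler_normD _ _))// mulrDl lerD.
Qed.

Lemma blinear_sum_fun X Y n (F : 'I_n -> X -> Y) :
  (forall i, bounded_linear (F i)) -> bounded_linear (fun x => \sum_i F i x).
Proof.
elim: n F => [|n IH] F bF.
  rewrite (_ : (fun x => _) = (fun=> 0)); last first.
    by apply/funext => x; rewrite big_ord0.
  split; first by move=> a x y; rewrite scaler0 addr0.
  by exists 0 => // x; rewrite normr0 mul0r.
rewrite (_ : (fun x => _) =
    (fun x => F ord0 x + \sum_(i < n) F (lift ord0 i) x)); last first.
  by apply/funext => x; rewrite big_ord_recl.
by apply: blinear_add => //; exact: IH.
Qed.

Lemma blinear_scale_vector X Y (phi : X -> R^o) (e : Y) :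
  bounded_linear phi -> bounded_linear (fun x => (phi x : R) *: e).
Proof.
move=> bphi; split.
  move=> a x y; rewrite (blinearD bphi) (blinearZ bphi).
  by rewrite scalerDl scalerA.
have [C C0 LC] := bphi.2; exists (C * `|e|) => [|x]; first exact: mulr_ge0.
by rewrite normrZ mulrAC ler_wpM2r// LC.
Qed.

Context (X Y : normedModType R) (c : {bilinear X -> Y -> R | *%R & *%R}).
Hypothesis c_bounded : form_bounded c.

Lemma form_boundedE : exists2 C, 0 <= C & forall x y, `|c x y| <= C * `|x| * `|y|.
Proof.
have [C Cc] := c_bounded; exists `|C| => // x y.
by rewrite (le_trans (Cc x y))// !ler_wpM2r// ler_norm.
Qed.

Lemma form_blinearl y : bounded_linear (c^~ y : X -> R^o).
Proof.
split; first by move=> a u v; rewrite linearDl linearZl_LR.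
have [C C0 Cc] := form_boundedE; exists (C * `|y|) => [|x]; first exact: mulr_ge0.
by rewrite mulrAC; exact: Cc.
Qed.

Lemma form_blinearr x : bounded_linear (c x : Y -> R^o).
Proof.
split; first by move=> a u v; rewrite linearDr linearZr_LR.
have [C C0 Cc] := form_boundedE; exists (C * `|x|) => [|y]; first exact: mulr_ge0.
exact: Cc.
Qed.

End bounded_linear_constructions.

Lemma orthoproj_blinear (R : realType) (X : normedModType R)
    (c : {bilinear X -> X -> R | *%R & *%R}) n (e : 'I_n -> X) :
  form_bounded c -> bounded_linear (orthoproj c e).
Proof.
move=> bc; apply: blinear_sum_fun => j.
exact/blinear_scale_vector/form_blinearl.
Qed.

Section weak_identity.
Context (R : realType) (X : normedModType R) (T : R) (u w : R -> X).
Notation mu := (@lebesgue_measure R).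
Hypothesis uw : borel_derivative T u w.
Context (phi : X -> R^o) (bphi : bounded_linear phi).

Lemma functional_integrable : mu.-integrable `[0, T] (EFin \o (phi \o w : R -> R)).
Proof.
exact: (borel_derivative_integrable (borel_derivative_map bphi uw)).
Qed.

Lemma functional_primitive t : t \in `[0, T] ->
  phi (u t) = phi (u 0) + primitive (phi \o w) t :> R.
Proof.
move=> /(borel_derivative_primitive (borel_derivative_map bphi uw)) <-.
by rewrite /= addrC subrK.
Qed.

Lemma functional_continuous : 0 <= T ->
  {within `[0, T], continuous (fun t => phi (u t) : R)}.
Proof.
move=> T0; have cp := primitive_continuous T0 functional_integrable.
have cs : {within `[0, T],
    continuous (fun t => phi (u 0) + primitive (phi \o w) t : R)}.
  by move=> t; apply: cvgD; [exact: cvg_cst|exact: cp].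
apply: subspace_eq_continuous cs => t /set_mem tT.
exact: (esym (functional_primitive tT)).
Qed.

End weak_identity.

Section derivative_in_subspace.
Context (R : realType) (X : normedModType R).
Notation mu := (@lebesgue_measure R).
Context (c : {bilinear X -> X -> R | *%R & *%R}).
Hypotheses (c_bounded : form_bounded c) (c_sym : form_symmetric c).
Hypothesis c_pos : forall x, x != 0 -> 0 < c x x.

(** The functionals c(., y - P y), with P the projection onto the span, vanish on
    u, hence almost everywhere on w, and simultaneously for the countably many
    values y of the simple functions approximating w. By linearity and passing to
    the limit the choice y = w t is allowed at almost all t, and it gives
    c(w t - P (w t), w t - P (w t)) = 0. *)
Lemma derivative_in_span n (e : 'I_n -> X) (T : R) (u w : R -> X) :
  orthonormal_family c e -> borel_derivative T u w ->
  (forall t, t \in `[0, T] -> spanned e (u t)) ->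
  {ae mu, forall t, t \in `]0, T[ -> spanned e (w t)}.
Proof.
move=> oe uw ue.
have perp (y : X) :
    {ae mu, forall t, t \in `]0, T[ -> c (w t) (y - orthoproj c e y) = 0}.
  have bphi := form_blinearl c_bounded (y - orthoproj c e y).
  have phi0 t : t \in `[0, T] -> c (u t) (y - orthoproj c e y) = 0.
    by move=> tT; apply: orthoproj_perp => //; exact: ue.
  apply: (primitive_eq0_ae (functional_integrable uw bphi)) => t tT.
  have := functional_primitive uw bphi tT; rewrite !phi0 ?add0r//.
  move: tT; rewrite !in_itv/= lexx => /andP[]; exact: le_trans.
have [[s sw] _ _] := uw.
have perp_all : {ae mu, forall t, forall n i, t \in `]0, T[ ->
    c (w t) (@sf_val _ _ (s n) i - orthoproj c e (sf_val i)) = 0}.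
  apply: ae_foralln => m.
  apply: (@filter_forall _ _ _ _ (ae_filter_ringOfSetsType mu)) => i.
  exact: perp.
apply: aeS perp_all => t perpt tT.
set z := w t - orthoproj c e (w t).
suff z0 : z = 0.
  by move/eqP: z0; rewrite subr_eq0 => /eqP->; exact: orthoproj_in.
have wz : c (w t) z = 0.
  pose psi y : R^o := c (w t) (y - orthoproj c e y).
  have bpsi : bounded_linear psi.
    apply: (blinear_comp (L := fun y => y - orthoproj c e y)); last exact: form_blinearr.
    rewrite (_ : (fun y => _) = (fun y => y + (-1) *: orthoproj c e y)); last first.
      by apply/funext => y; rewrite scaleN1r.
    apply: blinear_add.
      by split=> [a x y//|]; exists 1 => // x; rewrite mul1r.
    apply: (blinear_comp (L := orthoproj c e)); last exact: scale_blinear.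
    exact: orthoproj_blinear.
  have h := blinear_cvg bpsi (sw t).
  apply: (cvg_unique (@norm_hausdorff _ R^o) h).
  rewrite (_ : (fun n => _) = (fun=> 0)); first exact: cvg_cst.
  apply/funext => m; rewrite /sf_fun (blinear_sum bpsi) big1// => i _.
  by rewrite (blinearZ bpsi) /psi perpt// scaler0.
apply/eqP/negPn/negP => /c_pos; rewrite {1}/z linearBl wz orthoproj_perp//.
  by rewrite subrr ltxx.
exact: orthoproj_in.
Qed.

(** The derivative of c(u, u) is 2 c(u, w): by Parseval's identity, this is the
    chain rule for the square of each coordinate of u. *)
Lemma energy_primitive n (e : 'I_n -> X) (T : R) (u w : R -> X) : 0 <= T ->
  orthonormal_family c e -> borel_derivative T u w -> u 0 = 0 ->
  (forall t, t \in `[0, T] -> spanned e (u t)) ->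
  mu.-integrable `[0, T] (EFin \o (fun s => c (u s) (w s))) /\
  forall t, t \in `[0, T] ->
    c (u t) (u t) = 2 * \int[mu]_(s in `[0, t]) c (u s) (w s).
Proof.
move=> T0 oe uw u0 ue.
have bphi i := form_blinearl c_bounded (e i).
have cE i t : t \in `[0, T] -> c (u t) (e i) = primitive (fun s => c (w s) (e i)) t.
  by move=> /(functional_primitive uw (bphi i)); rewrite u0 linear0l add0r.
pose h i s := primitive (fun s => c (w s) (e i)) s * c (w s) (e i).
have ih i : mu.-integrable `[0, T] (EFin \o h i).
  have ii := functional_integrable uw (bphi i).
  by apply: integrable_continuousM => //; exact: primitive_continuous.
have uwE t : t \in `[0, T] -> c (u t) (w t) = \sum_i h i t.
  move=> tT; rewrite (parseval c_sym _ oe (ue t tT)).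
  by apply: eq_bigr => i _; rewrite cE.
split.
  have ish : mu.-integrable `[0, T] (EFin \o (fun s => \sum_i h i s)).
    exact: integrable_sum_ord.
  apply: eq_integrable ish => // t /set_mem tT /=.
  by rewrite uwE.
move=> t tT; have tT' : t <= T by move: tT; rewrite in_itv/= => /andP[].
have -> : \int[mu]_(s in `[0, t]) c (u s) (w s) =
    \int[mu]_(s in `[0, t]) \sum_i h i s.
  apply: eq_Rintegral => s /set_mem st; rewrite uwE//.
  exact: sub_segment0 st.
rewrite Rintegral_sum_ord//; last by move=> i; exact: integrable_sub0 (ih i).
rewrite (parseval c_sym _ oe (ue t tT)) mulr_sumr; apply: eq_bigr => i _.
rewrite -expr2 cE// (@primitive_sqr _ T)//.
exact: (functional_integrable uw (bphi i)).
Qed.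

(** By Parseval's identity c(u, u) is a sum of squares of continuous functions. *)
Lemma form_integrable n (e : 'I_n -> X) (T : R) (u w : R -> X) : 0 <= T ->
  orthonormal_family c e -> borel_derivative T u w ->
  (forall t, t \in `[0, T] -> spanned e (u t)) ->
  mu.-integrable `[0, T] (EFin \o (fun s => c (u s) (u s))).
Proof.
move=> T0 oe uw ue.
have cc i : {within `[0, T], continuous (fun s => c (u s) (e i))}.
  exact: (functional_continuous uw (form_blinearl c_bounded (e i))).
have ish : mu.-integrable `[0, T]
    (EFin \o (fun s => \sum_i c (u s) (e i) * c (u s) (e i))).
  apply: integrable_sum_ord => // i; apply: integrable_continuousM => //.
  by apply: continuous_compact_integrable => //; exact: segment_compact.
apply: eq_integrable ish => // t /set_mem tT /=.
by rewrite [in RHS](parseval c_sym _ oe (ue t tT)).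
Qed.

End derivative_in_subspace.

(** * Energy norms and the elliptic projection *)

Section energy_norms.
Context (R : realType) (X : normedModType R).
Context (c : {bilinear X -> X -> R | *%R & *%R}).

Lemma elliptic_gt0 : form_elliptic c -> forall x, x != 0 -> 0 < c x x.
Proof.
move=> [alpha alpha0 h] x x0; apply: lt_le_trans (h x).
by rewrite mulr_gt0// exprn_gt0// normr_gt0.
Qed.

Lemma elliptic_ge0 : form_elliptic c -> forall x, 0 <= c x x.
Proof.
move=> h x; have [->|/(elliptic_gt0 h)/ltW//] := eqVneq x 0.
by rewrite linear0l.
Qed.

Lemma energy_norm_sqr x : form_elliptic c -> energy_norm c x ^+ 2 = c x x.
Proof. by move=> h; rewrite sqr_sqrtr// elliptic_ge0. Qed.

Lemma energy_norm_le : form_bounded c ->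
  exists2 C, 0 <= C & forall x, energy_norm c x <= C * `|x|.
Proof.
move=> /form_boundedE[C C0 cC]; exists (Num.sqrt C) => [|x]; first exact: sqrtr_ge0.
rewrite /energy_norm -[`|x|]ger0_norm// -sqrtr_sqr -sqrtrM// ler_sqrt.
  by rewrite expr2 mulrA (le_trans (ler_norm _)).
by rewrite mulr_ge0// sqr_ge0.
Qed.

(** The Cauchy-Schwarz inequality for a unit vector v, from the sign of
    c(x - c(x, v) v, x - c(x, v) v). *)
Lemma form_unit_le x v : form_symmetric c -> form_elliptic c ->
  energy_norm c v = 1 -> c x v <= energy_norm c x.
Proof.
move=> sc ec v1; have cv : c v v = 1 by rewrite -energy_norm_sqr// v1 expr1n.
rewrite (le_trans (ler_norm _))// -sqrtr_sqr ler_sqrt ?elliptic_ge0//.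
have := elliptic_ge0 ec (x - c x v *: v).
rewrite linearBl !linearBr !linearZl_LR !linearZr_LR cv (sc v x).
by rewrite expr2 /= mulr1 subrr subr0 subr_ge0.
Qed.

End energy_norms.

Lemma le_dual_norm (R : realType) (X : normedModType R) (phi : X -> R^o) (x : X) :
  bounded_linear phi -> `|phi x| <= dual_norm phi * `|x|.
Proof.
move=> bphi.
have phiD : phi \in @dual_pred R X.
  by apply/dual_predP; split; [exact: bphi.1|exact: blinear_continuous].
have [->|x0] := eqVneq x 0; first by rewrite blinear0// !normr0 mulr0.
have nx : 0 < `|x| by rewrite normr_gt0.
have := dual_norm_ubound (Dual phiD) (x := `|x|^-1 *: x).
rewrite normrZ normfV normr_id mulVf ?gt_eqF// lexx => /(_ isT).
rewrite /= (blinearZ bphi) normrM normfV normr_id mulrC.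
by rewrite ler_pdivrMr.
Qed.

Section time.
Context (R : realType) (X : normedModType R).
Notation mu := (@lebesgue_measure R).

Lemma dtP (T : R) (u : R -> X) : H1 T u -> is_time_derivative T u (dt T u).
Proof. by move=> [w uw]; rewrite /dt; case: xgetP => [y _|/(_ w)]. Qed.

Lemma ae_neq (x : R) : {ae mu, forall t, t != x}.
Proof.
exists [set x]; split => //; first exact: lebesgue_measure_set1.
by move=> t /= /negP; rewrite negbK => /eqP.
Qed.

Lemma continuous_eq0_end (T : R) (F : R -> R) : 0 < T ->
  {within `[0, T], continuous F} -> (forall t, t \in `]0, T[ -> F t = 0) ->
  F T = 0.
Proof.
move=> T0 /(continuous_within_itvP _ T0)[_ _ FT] F0.
apply: (cvg_unique (@norm_hausdorff _ R^o) FT).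
apply: cvg_near_cst; near=> t; apply: F0.
by rewrite in_itv/=; apply/andP; split.
Unshelve. all: by end_near. Qed.

End time.

(** In orthonormal bases the projection has the explicit form pt = P p and
    ut = P u + S (pt - p) with bounded linear maps, so that its time derivative
    is the image of those of u and p. The map S solves a (S q) v = b v (i q) in
    the discrete space. *)
Lemma elliptic_projection_H1 (R : realType) (V Q Q0 : normedModType R)
    (i : {linear Q -> Q0}) (a : {bilinear V -> V -> R | *%R & *%R})
    (k : {bilinear Q -> Q -> R | *%R & *%R})
    (b : {bilinear V -> Q0 -> R | *%R & *%R}) (T : R)
    n (e : 'I_n -> V) m (f : 'I_m -> Q) (u : R -> V) (p : R -> Q)
    (ut : R -> V) (pt : R -> Q) :
  0 <= T ->
  form_bounded a -> form_symmetric a -> (forall x, x != 0 -> 0 < a x x) ->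
  form_bounded k -> form_symmetric k -> (forall x, x != 0 -> 0 < k x x) ->
  form_bounded b -> bounded_linear i ->
  orthonormal_family a e -> orthonormal_family k f ->
  is_elliptic_projection i a k b T (spanned e) (spanned f) u p ut pt ->
  H1 T u -> H1 T p -> H1 T ut /\ H1 T pt.
Proof.
move=> T0 ba sa pa bk sk pk bb bi oe of_ proj [du /borel_derivative_exists[u' uu' _]].
move=> [dp /borel_derivative_exists[p' pp' _]].
have ptE t : t \in `[0, T] -> orthoproj k f (p t) = pt t.
  move=> /proj[_ ptf _ kp]; apply: (form_eq_in pk) ptf _.
    exact: orthoproj_in.
  move=> q qf; have := orthoproj_perp sk (p t) of_ qf; have := kp q qf.
  rewrite linearBl linearBr => /subr0_eq-> /subr0_eq.
  by rewrite sk => ->; rewrite sk.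
pose S q := \sum_j (b (e j) (i q) : R) *: e j.
have bS : bounded_linear S.
  apply: blinear_sum_fun => j; apply: blinear_scale_vector.
  by apply: (blinear_comp bi); exact: form_blinearr.
have Sb q v : spanned e v -> a (S q) v = b v (i q).
  move=> ev; rewrite sa (parseval sa _ oe ev) -{2}(orthoproj_id oe ev).
  rewrite linear_sumlz; apply: eq_bigr => j _.
  by rewrite linearZl_LR orthonormal_coord.
have utE t : t \in `[0, T] ->
    orthoproj a e (u t) + S (pt t + (-1) *: p t) = ut t.
  move=> tT; have [ute _ au _] := proj t tT; apply: (form_eq_in pa) ute _.
    by apply: spannedD; [exact: orthoproj_in|];
      exists (fun j => b (e j) (i (pt t + (-1) *: p t))).
  move=> v ev; have := orthoproj_perp sa (u t) oe ev; have := au v ev.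
  rewrite [a (_ + S _) _]linearDl Sb// scaleN1r [a (ut t - _) _]linearBl linearBr.
  move=> h /subr0_eq h2.
  by rewrite [a (orthoproj _ _ _) _]sa -h2 [a v _]sa; lra.
have ptB : borel_derivative T pt (orthoproj k f \o p').
  apply: (borel_derivative_eq T0 ptE).
  exact: (borel_derivative_map (orthoproj_blinear f bk) pp').
have pB := borel_derivative_map (scale_blinear _ (-1)) pp'.
have SB := borel_derivative_map bS (borel_derivativeD ptB pB).
have uB := borel_derivative_map (orthoproj_blinear e ba) uu'.
have utB := borel_derivative_eq T0 utE (borel_derivativeD uB SB).
by split; eexists; apply: borel_derivative_time; [exact: utB|exact: ptB].
Qed.

(** * The discrete error *)

Section discrete_error.
Context (R : realType) (V Q Q0 : normedModType R).
Notation mu := (@lebesgue_measure R).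
Context (i : {linear Q -> Q0}) (a : {bilinear V -> V -> R | *%R & *%R})
  (k : {bilinear Q -> Q -> R | *%R & *%R})
  (b : {bilinear V -> Q0 -> R | *%R & *%R}).
Hypotheses (a_bounded : form_bounded a) (a_elliptic : form_elliptic a)
  (a_sym : form_symmetric a).
Hypotheses (k_bounded : form_bounded k) (k_elliptic : form_elliptic k)
  (k_sym : form_symmetric k).
Hypotheses (b_bounded : form_bounded b)
  (norm_i_le : forall q, `|i q| <= energy_norm k q).
Context (T : R) (f : R -> dual V) (g : R -> dual Q) (u : R -> V) (p : R -> Q).
Hypotheses (T_gt0 : 0 < T) (up_sol : is_solution i a k b T f g setT setT u p).
Context n (e : 'I_n -> V) m (d : 'I_m -> Q).
Hypotheses (e_on : orthonormal_family a e) (d_on : orthonormal_family k d).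
Context (ut : R -> V) (pt : R -> Q) (uh : R -> V) (ph : R -> Q).
Hypotheses
  (utpt_proj : is_elliptic_projection i a k b T (spanned e) (spanned d) u p ut pt)
  (uhph_sol : is_solution i a k b T f g (spanned e) (spanned d) uh ph)
  (uh0 : uh 0 = ut 0) (ph0 : ph 0 = pt 0).

Let a_gt0 := elliptic_gt0 a_elliptic.
Let k_gt0 := elliptic_gt0 k_elliptic.

Lemma embedding_blinear : bounded_linear i.
Proof.
split; first by move=> r x y; rewrite linearP.
have [C C0 kC] := energy_norm_le k_bounded.
by exists C => // q; exact: le_trans (norm_i_le q) (kC q).
Qed.

Lemma projection_H1 : H1 T ut /\ H1 T pt.
Proof.
have [[u1 p1] _ _ _] := up_sol.
by apply: (elliptic_projection_H1 (ltW T_gt0) a_bounded a_sym a_gt0 k_bounded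
  k_sym k_gt0 b_bounded embedding_blinear e_on d_on utpt_proj).
Qed.

Lemma displacement_error_in t : t \in `[0, T] -> spanned e (uh t - ut t).
Proof.
move=> tT; have [_ /(_ t tT)[? _] _ _] := uhph_sol.
by have [? _ _ _] := utpt_proj tT; exact: spannedB.
Qed.

Lemma pressure_error_in t : t \in `[0, T] -> spanned d (ph t - pt t).
Proof.
move=> tT; have [_ /(_ t tT)[_ ?] _ _] := uhph_sol.
by have [_ ? _ _] := utpt_proj tT; exact: spannedB.
Qed.

Lemma error_static_interior t v : t \in `]0, T[ -> spanned e v ->
  a (uh t - ut t) v = b v (i (ph t - pt t)).
Proof.
move=> tT ev; have [_ _ fh _] := uhph_sol; have [_ _ fu _] := up_sol.
have [_ _ /(_ v ev) + _] := utpt_proj (in_segment_oo tT).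
have := fu t tT v I; rewrite -(fh t tT v ev).
by rewrite !linearBl !raddfB/=; lra.
Qed.

Lemma pressure_error_derivative : exists w,
  borel_derivative T (fun t => ph t - pt t) w.
Proof.
have [[_ /dtP/borel_derivative_exists[w1 w1P _]] _ _ _] := uhph_sol.
have [_ /dtP/borel_derivative_exists[w2 w2P _]] := projection_H1.
by exists (fun t => w1 t - w2 t); exact: borel_derivativeB.
Qed.

Lemma displacement_error_derivative : exists2 w,
  borel_derivative T (fun t => uh t - ut t) w &
  {ae mu, forall t, t \in `[0, T] -> w t = dt T uh t - dt T ut t}.
Proof.
have [[/dtP/borel_derivative_exists[w1 w1P w1E] _] _ _ _] := uhph_sol.
have [/dtP/borel_derivative_exists[w2 w2P w2E] _] := projection_H1.
exists (fun t => w1 t - w2 t); first exact: borel_derivativeB.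
by apply: aeS (aeI w1E w2E) => t [h1 h2] tT; rewrite h1// h2.
Qed.

(** The endpoint 0 is covered by the initial conditions and T by continuity. *)
Lemma error_static t v : t \in `[0, T] -> spanned e v ->
  a (uh t - ut t) v = b v (i (ph t - pt t)).
Proof.
move=> tT ev.
have [t0|t0] := eqVneq t 0.
  by rewrite t0 uh0 ph0 !subrr raddf0 linear0l linear0r.
have [tE|tT'] := eqVneq t T; last first.
  apply: error_static_interior => //; move: tT; rewrite !in_itv/=.
  by rewrite !le_eqVlt (negbTE tT') eq_sym (negbTE t0).
have [w wP] := pressure_error_derivative.
have [z zP _] := displacement_error_derivative.
have ca := functional_continuous zP (form_blinearl a_bounded v) (ltW T_gt0).
have cb := functional_continuous wP
  (blinear_comp embedding_blinear (form_blinearr b_bounded v)) (ltW T_gt0).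
apply/eqP; rewrite -subr_eq0 tE; apply/eqP.
pose F s := a (uh s - ut s) v - b v (i (ph s - pt s)).
apply: (@continuous_eq0_end _ T F) => //.
  by move=> s; apply: cvgB; [exact: ca|exact: cb].
by move=> s sT; rewrite /F error_static_interior// subrr.
Qed.

Lemma error_dynamic : {ae mu, forall t, t \in `]0, T[ ->
  forall q, spanned d q ->
    b (dt T uh t - dt T ut t) (i q) + k (ph t - pt t) q =
    b (dt T u t - dt T ut t) (i q)}.
Proof.
have [_ _ _ gu] := up_sol; have [_ _ _ gh] := uhph_sol.
apply: aeS (aeI gu gh) => t [gut ght] tT q dq.
have [_ _ _ /(_ q dq)] := utpt_proj (in_segment_oo tT).
have := gut tT q I; rewrite -(ght tT q dq).
by rewrite !linearBl; lra.
Qed.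

(** Testing the static equation with the derivative w of the displacement error
    and the dynamic one with the pressure error makes the two coupling terms
    b (w t) (i (ph t - pt t)) equal. With D the dual norm, y = |i (ph t - pt t)|
    and x the energy norm of the pressure error, which bounds y, the left-hand
    side is then at most 2 D y - x^2 <= 2 D y - y^2 <= D^2. *)
Lemma error_power_le : exists2 w,
  borel_derivative T (fun t => uh t - ut t) w &
  {ae mu, forall t, t \in `]0, T[ ->
    2 * a (uh t - ut t) (w t) + k (ph t - pt t) (ph t - pt t) <=
    dual_norm (b (dt T u t - dt T ut t)) ^+ 2}.
Proof.
have [w wP wE] := displacement_error_derivative; exists w => //.
have we := derivative_in_span a_bounded a_sym a_gt0 e_on wP displacement_error_in.
apply: aeS (aeI wE (aeI we error_dynamic)) => t [wt [wte dyn]] tT.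
have tT' := in_segment_oo tT.
have := dyn tT _ (pressure_error_in tT').
rewrite error_static//; last exact: wte.
rewrite -(wt tT').
have := le_dual_norm (i (ph t - pt t)) (form_blinearr b_bounded (dt T u t - dt T ut t)).
have := norm_i_le (ph t - pt t).
have := energy_norm_sqr (ph t - pt t) k_elliptic => <-.
set x := energy_norm _ _; set y := `|i _|; set D := dual_norm _.
move=> yx Dy dynE.
have y2 : y ^+ 2 <= x ^+ 2 by rewrite ler_pXn2r// nnegrE ?normr_ge0 ?sqrtr_ge0.
have := le_trans (ler_norm _) Dy; rewrite -dynE => BD.
by have := sqr_ge0 (D - y); nra.
Qed.

Lemma energy_estimate t : t \in `[0, T] ->
  ((energy_norm a (uh t - ut t) ^+ 2)%:E +
   \int[mu]_(s in `[0%R, t]) (energy_norm k (ph s - pt s) ^+ 2)%:E <=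
   \int[mu]_(s in `[0%R, t])
     (dual_norm (b (dt T u s - dt T ut s)%R) ^+ 2)%:E)%E.
Proof.
move=> tT; have [w wP power] := error_power_le.
have [z zP] := pressure_error_derivative.
have T0 := ltW T_gt0.
have tT' : t <= T by move: tT; rewrite in_itv/= => /andP[].
have e0 : uh 0 - ut 0 = 0 by rewrite uh0 subrr.
have [iaw aE] := energy_primitive a_bounded a_sym T0 e_on wP e0
  displacement_error_in.
have ik := form_integrable k_bounded k_sym T0 d_on zP pressure_error_in.
have {}iaw := integrable_sub0 tT' iaw; have {}ik := integrable_sub0 tT' ik.
have i2aw : mu.-integrable `[0, t]
    (EFin \o (fun s => 2 * a (uh s - ut s) (w s))) by exact: integrableZ.
under eq_integral do rewrite energy_norm_sqr//.
rewrite energy_norm_sqr// aE// -RintegralZl// /Rintegral fineK; last first.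
  exact: (integrable_fin_num _ i2aw).
rewrite -integralD_EFin//.
apply: ae_le_lower_integral => //.
- exact: integrable_add.
- by move=> s _; exact: sqr_ge0.
apply: aeS (aeI power (aeI (ae_neq 0) (ae_neq T))) => s [h [s0 sT]] /= st.
apply: h; have := sub_segment0 tT' st; rewrite /= !in_itv/= !le_eqVlt.
by rewrite (negbTE sT) eq_sym (negbTE s0).
Qed.

Lemma pressure_error_le betah t :
  (forall q, spanned d q ->
    ((betah * `|i q|)%:E <= sup_unit a b (spanned e) (i q))%E) ->
  t \in `[0, T] ->
  betah * `|i (ph t - pt t)| <= energy_norm a (uh t - ut t).
Proof.
move=> infsup tT; rewrite -lee_fin.
apply: le_trans (infsup _ (pressure_error_in tT)) _.
apply: ge_ereal_sup => _ [v [ev v1] <-].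
by rewrite lee_fin -error_static// form_unit_le.
Qed.

End discrete_error.

Theorem lemma11 (R : realType) (V Q Q0 : completeNormedModType R)
  (hV : is_hilbert V) (hQ : is_hilbert Q) (hQ0 : is_hilbert Q0)
  (i : {linear Q -> Q0}) (i_inj : injective i) (i_compact : compact_map i)
  (i_dense : dense (range i))
  (a : {bilinear V -> V -> R | *%R & *%R})
  (k : {bilinear Q -> Q -> R | *%R & *%R})
  (b : {bilinear V -> Q0 -> R | *%R & *%R})
  (A1 : [/\ form_bounded a, form_elliptic a & form_symmetric a])
  (A2 : [/\ form_bounded k, form_elliptic k & form_symmetric k])
  (A3_bounded : exists2 Cb : R, 0 < Cb &
     forall (v : V) (q : Q0), b v q <= Cb * energy_norm a v * `|q|)
  (A3_infsup : exists2 beta : R, 0 < beta &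
     forall q : Q0, ((beta * `|q|)%:E <= sup_unit a b setT q)%E)
  (norm_Q0_le : forall q : Q, `|i q| <= energy_norm k q)
  (T : R) (T_gt0 : 0 < T)
  (f : R -> dual V) (f_H1 : H1 T f) (g : R -> dual Q) (g_L2 : L2 T g)
  (u : R -> V) (p : R -> Q)
  (up_sol : is_solution i a k b T f g setT setT u p)
  (Vh : set V) (Vh_fin : finite_dim_subspace Vh)
  (Qh : set Q) (Qh_fin : finite_dim_subspace Qh)
  (ut : R -> V) (pt : R -> Q)
  (utpt_proj : is_elliptic_projection i a k b T Vh Qh u p ut pt)
  (uh : R -> V) (ph : R -> Q)
  (uhph_sol : is_solution i a k b T f g Vh Qh uh ph)
  (uh0 : uh 0 = ut 0) (ph0 : ph 0 = pt 0) :
  (forall t, t \in `[0, T] ->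
     ((energy_norm a (uh t - ut t) ^+ 2)%:E +
      \int[lebesgue_measure]_(s in `[0%R, t])
         (energy_norm k (ph s - pt s) ^+ 2)%:E <=
      \int[lebesgue_measure]_(s in `[0%R, t])
         (dual_norm (b (dt T u s - dt T ut s)%R) ^+ 2)%:E)%E) /\
  (forall betah : R, 0 < betah ->
     (forall q : Q, Qh q ->
        ((betah * `|i q|)%:E <= sup_unit a b Vh (i q))%E) ->
     forall t, t \in `[0, T] ->
       betah * `|i (ph t - pt t)| <= energy_norm a (uh t - ut t)).
Proof.
have [ba ea sa] := A1; have [bk ek sk] := A2; have [Cb Cb0 bC] := A3_bounded.
have [CA CA0 aC] := energy_norm_le ba.
(* The one-sided bound on b, applied to q and to - q, is a two-sided one. *)
have bb : form_bounded b.
  exists (Cb * CA) => v q.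
  apply: (@le_trans _ _ (Cb * energy_norm a v * `|q|)); last first.
    by rewrite ler_wpM2r// -mulrA ler_wpM2l// ltW.
  rewrite ler_norml bC andbT lerNl -linearNr.
  by rewrite (le_trans (bC v (- q)))// normrN.
have [n [e0 VhE]] := Vh_fin; have [m [d0 QhE]] := Qh_fin.
have [n' [e [e_on eE]]] := orthonormal_basis_exists sa (elliptic_gt0 ea) e0.
have [m' [d [d_on dE]]] := orthonormal_basis_exists sk (elliptic_gt0 ek) d0.
have {}VhE : Vh = spanned e by rewrite eE.
have {}QhE : Qh = spanned d by rewrite dE.
subst Vh Qh; split=> [t tT|betah beta0 infsup t tT].
  exact: (energy_estimate ba ea sa bk ek sk bb norm_Q0_le T_gt0 up_sol e_on d_on
    utpt_proj uhph_sol).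
exact: (pressure_error_le ba ea sa bk ek sk bb norm_Q0_le T_gt0 up_sol e_on d_on
  utpt_proj uhph_sol uh0 ph0 infsup).
Qed.
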